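(* Let $\mathbb{K}$ be a field, $S=\mathbb{K}[x_1,\dots,x_n]$, and let $I\subset S$ be a monomial ideal with analytic spread $\ell=\ell(I)$. Set $s=\mu(\overline{I^{\ell-1}})!$ (factorial). Then for every integer $m\geq 1$, we have $${\rm depth}(S/I^{sm})\leq {\rm depth}(S/\overline{I}).$$
   Context: For a monomial ideal $J\subseteq S$, $\mu(J)$ denotes the number of minimal monomial generators of $J$, and $\overline{J}$ denotes the integral closure of $J$, which is the monomial ideal generated by all monomials $u\in S$ such that $u^r\in J^r$ for some integer $r\geq 1$. $I^0=S$. The analytic spread $\ell(I)$ is the Krull dimension of $\mathcal{R}(I)/\mathfrak{m}\mathcal{R}(I)$, where $\mathcal{R}(I)=\bigoplus_{k\geq 0}I^k$ is the Rees algebra of $I$ and $\mathfrak{m}=(x_1,\dots,x_n)$. Depth is taken with respect to $\mathfrak{m}$. *)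

(* Defs.v *)
(* [mpoly] has to be imported before [constructive_ereal]: in the other order
   their notations clash. *)
From HB Require Import structures.
From mathcomp Require Import all_boot all_order all_algebra ring_quotient.
From mathcomp Require Import mpoly.
From mathcomp Require Import finmap boolp classical_sets functions cardinality.
From mathcomp Require Import constructive_ereal.

Set Implicit Arguments.
Unset Strict Implicit.
Unset Printing Implicit Defensive.

Import Order.TTheory GRing.Theory.

Local Open Scope classical_set_scope.
Local Open Scope ring_scope.

Section Ideals.
Variable R : comNzRingType.
Implicit Types A B P : set R.

(* The unit ideal [setT] is allowed, unlike in [ring_quotient]. *)
Definition is_ideal A : Prop :=
  [/\ A 0, (forall x y, A x -> A y -> A (x + y))
    & (forall a x, A x -> A (a * x))].

Definition ideal_gen A : set R := smallest is_ideal A.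

Lemma ideal_genP A : is_ideal (ideal_gen A).
Proof.
split=> [B [[]]//|x y Ax Ay B BA|a x Ax B BA].
- by case: (BA) => -[_ BD _] _; apply: BD; [exact: Ax|exact: Ay].
- by case: (BA) => -[_ _ BM] _; apply: BM; exact: Ax.
Qed.

Lemma ideal_gen_min A B : is_ideal B -> A `<=` B -> ideal_gen A `<=` B.
Proof. by move=> Bid AB x; apply. Qed.

Lemma sub_ideal_gen A : A `<=` ideal_gen A.
Proof. exact: sub_gen_smallest. Qed.

Definition ideal_prod A B : set R :=
  ideal_gen [set x | exists a b, [/\ A a, B b & x = a * b]].

Definition ideal_pow A (k : nat) : set R := iter k (ideal_prod A) setT.

Lemma ideal_powP A k : is_ideal (ideal_pow A k).
Proof. by case: k => [|k]; [split|exact: ideal_genP]. Qed.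

Lemma ideal_powM A i j x y :
  ideal_pow A i x -> ideal_pow A j y -> ideal_pow A (i + j) (x * y).
Proof.
elim: i x y => [|i IHi] x y; first by case: (ideal_powP A j) => _ _ + _; apply.
move=> Ax Ay; have [P0 PD PM] := ideal_powP A (i.+1 + j).
pose B : set R := [set z | ideal_pow A (i.+1 + j) (z * y)].
apply: (@ideal_gen_min _ B _ _ x Ax).
  split=> [|u v Bu Bv|a u Bu]; rewrite /B /= ?mul0r ?mulrDl -?mulrA //.
    exact: PD.
  exact: PM.
move=> _ [a [b [Aa Ab ->]]]; rewrite /B /= -mulrA.
by apply: sub_ideal_gen; exists a, (b * y); split=> //; exact: IHi.
Qed.

Definition is_prime_ideal P : Prop :=
  [/\ is_ideal P, ~ P 1 & forall x y, P (x * y) -> P x \/ P y].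

Definition prime_chain (P : nat -> set R) (d : nat) : Prop :=
  (forall i, (i <= d)%N -> is_prime_ideal (P i)) /\
  (forall i, (i < d)%N -> P i `<` P i.+1).

Definition krull_dim : \bar int :=
  supremum -oo%E [set (d%:Z)%:E | d in [set d | exists P : nat -> set R, prime_chain P d]].

(* [f] is a regular sequence on the module R/J: writing J_i for
   J + (f_0, ..., f_(i-1)), the element f_i is a nonzerodivisor on R/J_i for
   every i, and R/J_(size f) is nonzero. *)
Definition regular_seq (J : set R) (f : seq R) : Prop :=
  (forall i g, (i < size f)%N ->
     ideal_gen (J `|` [set` take i f]) (g * f`_i) ->
     ideal_gen (J `|` [set` take i f]) g) /\
  ideal_gen (J `|` [set` f]) <> setT.

(* The depth of R/J with respect to the ideal [m], the zero module having
   infinite depth. *)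
Definition depth_quot (m J : set R) : \bar int :=
  if `[< J = setT >] then +oo%E else
  supremum -oo%E [set ((size f)%:Z)%:E | f in
    [set f : seq R | [set` f] `<=` m /\ regular_seq J f]].

(* The Rees algebra, as the subring of R[t] of the polynomials whose
   coefficient of t^k lies in I^k for every k. *)
Definition rees_pred (I : set R) : {pred {poly R}} :=
  fun p => `[< forall k, ideal_pow I k p`_k >].

Lemma rees_subring I : subring_closed (rees_pred I).
Proof.
have PN k x : ideal_pow I k x -> ideal_pow I k (- x).
  by rewrite -mulN1r; case: (ideal_powP I k) => _ _; apply.
split=> [|p q /asboolP Ip /asboolP Iq|p q /asboolP Ip /asboolP Iq];
    apply/asboolP=> k.
- by rewrite coef1; case: k => [//|k] /=; case: (ideal_powP I k.+1).
- by rewrite coefB; case: (ideal_powP I k) => _ + _; apply=> //; exact: PN.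
- rewrite coefM; case: (ideal_powP I k) => P0 PD _.
  elim/big_ind: _ => // i _.
  by have := ideal_powM (Ip i) (Iq (k - i)%N); rewrite subnKC // -ltnS.
Qed.

HB.instance Definition _ I :=
  GRing.isSubringClosed.Build {poly R} (rees_pred I) (rees_subring I).

Record rees_algebra (I : set R) : Type := ReesAlgebra {
  rees_val : {poly R};
  _ : rees_val \in rees_pred I
}.

HB.instance Definition _ I := [isSub for @rees_val I].
HB.instance Definition _ I := [Choice of rees_algebra I by <:].
HB.instance Definition _ I :=
  [SubChoice_isSubComNzRing of rees_algebra I by <:].

End Ideals.

Section MonomialIdeals.
Variables (K : fieldType) (n : nat).
Local Notation S := {mpoly K[n]}.
Implicit Types I J : set S.

Definition max_ideal : set S := ideal_gen (range (fun i : 'I_n => 'X_i)).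

Lemma max_ideal_coef0 (f : S) : max_ideal f -> f@_0%MM = 0.
Proof.
move=> mf; apply: (@ideal_gen_min _ _ [set g : S | g@_0%MM = 0] _ _ f mf).
  split=> [|g h /= g0 h0|g h /= h0]; first exact: mcoeff0.
    by rewrite mcoeffD g0 h0 addr0.
  by have /= -> := rmorphM (mcoeff 0%MM) g h; rewrite h0 mulr0.
by move=> _ [i _ <-]; rewrite /= mcoeffX mnm1_eq0.
Qed.

Definition is_monomial_ideal J : Prop :=
  exists G : set 'X_{1..n}, J = ideal_gen [set 'X_[u] | u in G].

(* A monomial ideal has a unique minimal set of monomial generators: the
   monomials of the ideal that are minimal for divisibility. *)
Definition min_gens J : set 'X_{1..n} :=
  [set u | J 'X_[u] /\ forall v, J 'X_[v] -> (v <= u)%MM -> v = u].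

Definition mu J : nat := #|` fset_set (min_gens J)|%fset.

Definition integral_closure J : set S :=
  ideal_gen [set 'X_[u] | u in
    [set u | exists2 r, (1 <= r)%N & ideal_pow J r ('X_[u] ^+ r)]].

Definition max_rees I : set (rees_algebra I) :=
  ideal_gen [set p | exists2 f, max_ideal f & val p = f%:P].
Arguments max_rees : clear implicits.

Definition max_rees_pred I : {pred rees_algebra I} :=
  fun p => p \in max_rees I.
Arguments max_rees_pred : clear implicits.

Lemma max_rees_idealr I : idealr_closed (max_rees_pred I).
Proof.
have [m0 mD mM] : is_ideal (max_rees I) by exact: ideal_genP.
have memE p : (p \in max_rees_pred I) = (p \in max_rees I) by [].
split=> [||a p q].
- by rewrite memE; exact/mem_set.
- rewrite memE; apply/negP=> /set_mem m1.
  pose B : set (rees_algebra I) := [set p | ((val p : {poly S})`_0)@_0%MM = 0].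
  suff: B 1 by move/eqP; rewrite /B /= coef1 mcoeff1 eqxx oner_eq0.
  apply: (@ideal_gen_min _ _ B _ _ 1 m1).
    split=> [|p q|p q]; rewrite /B /=.
    + by rewrite coef0 mcoeff0.
    + by move=> p0 q0; rewrite coefD mcoeffD p0 q0 addr0.
    + move=> q0; rewrite coef0M.
      have /= -> := rmorphM (mcoeff 0%MM) (val p : {poly S})`_0 (val q : {poly S})`_0.
      by rewrite q0 mulr0.
  by move=> p [f mf pf]; rewrite /B /= pf coefC /= max_ideal_coef0.
- rewrite !memE => /set_mem mp /set_mem mq.
  by apply: mem_set; apply: mD => //; exact: mM.
Qed.

HB.instance Definition _ I :=
  isIdealr.Build (rees_algebra I) (max_rees_pred I) (max_rees_idealr I).

Definition fiber_ring I : comNzRingType := {ideal_quot (max_rees_pred I)}.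

Definition analytic_spread I : \bar int := krull_dim (fiber_ring I).

End MonomialIdeals.

Arguments max_ideal {K n}.
Arguments max_rees {K n} I.
Arguments max_rees_pred {K n} I.

(* Main.v *)
From HB Require Import structures.
Require Import Defs.
From mathcomp Require Import all_boot all_order all_algebra.
From mathcomp Require Import generic_quotient ring_quotient.
From mathcomp Require Import mpoly.
From mathcomp Require Import finmap.
From mathcomp Require Import ring zify.
From mathcomp Require Import boolp classical_sets cardinality.
From mathcomp Require Import constructive_ereal.

Set Implicit Arguments.
Unset Strict Implicit.
Unset Printing Implicit Defensive.

Import Order.TTheory GRing.Theory Num.Theory.

Local Open Scope classical_set_scope.
Local Open Scope ring_scope.

(** Write I1 for the integral closure of I, put s = mu(closure of I^(l-1))! and
    I2 = I^(sm). A monomial u lies in I1 iff u^(sm) lies in I2. Hence the map phi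
    sending x_i to x_i^(sm) embeds S/I1 as a direct summand of S/I2 over S, and
    depth does not drop when passing to a direct summand. Since depth is defined
    by regular sequences, one needs on S/I2 a regular sequence of maximal length
    of the form phi(g_1), ..., phi(g_d): it is obtained from an arbitrary one by
    prime avoidance for the preimages under phi of the maximal annihilators, and
    by exchanging elements.

    For the criterion: the closure of I^l is I times the closure of I^(l-1), so u
    in I1 maps each minimal generator of the latter to a multiple of b v', with b
    in I and v' another generator, and a cycle of length k of v -> v' gives
    u^k in I^k with k dividing s. The equality of ideals is proved in the cone
    over the exponents of the generators of the Rees algebra: subtracting
    greedily multiples of generators writes a vector of degree l, up to multiples
    of variables, as a combination of generators b of I. Every step lands in a
    strictly smaller face, and the faces define a chain of primes of the fiber
    ring, so there are at most l steps and some coefficient is at least 1. *)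

(** * Regular sequences over a Noetherian ring *)

Section IdealTheory.
Variable R : comNzRingType.
Implicit Types (A B J P M : set R) (x y z f g u : R) (s : seq R).

Lemma ideal0 J : is_ideal J -> J 0.
Proof. by case. Qed.

Lemma idealD J x y : is_ideal J -> J x -> J y -> J (x + y).
Proof. by case=> _ + _; apply. Qed.

Lemma is_idealMl J a x : is_ideal J -> J x -> J (a * x).
Proof. by case=> _ _; apply. Qed.

Lemma is_idealMr J a x : is_ideal J -> J x -> J (x * a).
Proof. by rewrite mulrC; exact: is_idealMl. Qed.

Lemma idealN J x : is_ideal J -> J x -> J (- x).
Proof. by move=> Jid Jx; rewrite -mulN1r; exact: is_idealMl. Qed.

Lemma idealB J x y : is_ideal J -> J x -> J y -> J (x - y).
Proof. by move=> Jid Jx Jy; apply: idealD => //; exact: idealN. Qed.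

Lemma idealBl J x y : is_ideal J -> J (x - y) -> J y -> J x.
Proof. by move=> Jid Jxy Jy; rewrite -(subrK y x); exact: idealD. Qed.

Lemma ideal_sum J (I : Type) (r : seq I) (Q : pred I) (F : I -> R) :
  is_ideal J -> (forall i, Q i -> J (F i)) -> J (\sum_(i <- r | Q i) F i).
Proof.
move=> Jid JF; elim/big_ind: _ => //; first exact: ideal0.
by move=> x y; exact: idealD.
Qed.

Lemma ideal_gen_ind A (Q : R -> Prop) :
  Q 0 -> (forall x y, Q x -> Q y -> Q (x + y)) -> (forall a x, Q x -> Q (a * x)) ->
  (forall x, A x -> Q x) -> forall x, ideal_gen A x -> Q x.
Proof. by move=> Q0 QD QM AQ; apply: (@ideal_gen_min _ A Q). Qed.

Lemma ideal_gen_mono A B : A `<=` B -> ideal_gen A `<=` ideal_gen B.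
Proof.
move=> AB; apply: ideal_gen_min; first exact: ideal_genP.
exact: subset_trans AB (@sub_ideal_gen _ _).
Qed.

Lemma ideal_gen_id J : is_ideal J -> ideal_gen J = J.
Proof.
by move=> Jid; apply/seteqP; split; [exact: ideal_gen_min|exact: sub_ideal_gen].
Qed.

Lemma ideal_gen_genU A B : ideal_gen (ideal_gen A `|` B) = ideal_gen (A `|` B).
Proof.
apply/seteqP; split; last by apply: ideal_gen_mono; apply: setSU; exact: sub_ideal_gen.
apply: ideal_gen_min; first exact: ideal_genP.
move=> x [|Bx]; first by apply: ideal_gen_mono; exact: subsetUl.
by apply: sub_ideal_gen; right.
Qed.

Lemma ideal_gen_finite A x :
  ideal_gen A x -> exists2 s : seq R, [set` s] `<=` A & ideal_gen [set` s] x.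
Proof.
move: x; apply: ideal_gen_ind.
- by exists [::]; [|exact: ideal0 (ideal_genP _)].
- move=> x y [s sA sx] [t tA ty]; exists (s ++ t).
    by move=> z /=; rewrite mem_cat => /orP[/sA|/tA].
  apply: (idealD (ideal_genP _)).
    by apply: (ideal_gen_mono _ sx) => z /= zs; rewrite mem_cat zs.
  by apply: (ideal_gen_mono _ ty) => z /= zs; rewrite mem_cat zs orbT.
- by move=> a x [s sA sx]; exists s => //; exact: (is_idealMl _ (ideal_genP _)).
- move=> x Ax; exists [:: x]; first by move=> z /=; rewrite inE => /eqP->.
  by apply: sub_ideal_gen; rewrite /= inE.
Qed.

Definition adjoin J f := ideal_gen (J `|` [set f]).

Lemma adjoin_ideal J f : is_ideal (adjoin J f).
Proof. exact: ideal_genP. Qed.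
Hint Resolve adjoin_ideal : core.

Lemma adjoinE J f x : is_ideal J -> adjoin J f x <-> exists a, J (x - a * f).
Proof.
move=> Jid; split; last first.
  move=> [a Jxa]; apply: (idealBl (adjoin_ideal J f) (y := a * f)).
    by apply: sub_ideal_gen; left.
  by apply: (is_idealMl _ (adjoin_ideal J f)); apply: sub_ideal_gen; right.
move: x; apply: ideal_gen_ind.
- by exists 0; rewrite mul0r subr0; exact: ideal0.
- move=> x y [a Jx] [b Jy]; exists (a + b).
  by rewrite mulrDl opprD addrACA; exact: idealD.
- by move=> c x [a Jx]; exists (c * a); rewrite -mulrA -mulrBr; exact: is_idealMl.
- move=> x [Jx|->]; first by exists 0; rewrite mul0r subr0.
  by exists 1; rewrite mul1r subrr; exact: ideal0.
Qed.

Lemma adjoinC J f g : adjoin (adjoin J f) g = adjoin (adjoin J g) f.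
Proof. by rewrite /adjoin !ideal_gen_genU setUAC. Qed.

Definition nzd J f := forall g, J (g * f) -> J g.

(** Only the nonzerodivisor half of [regular_seq], recursive in the ideal so that inductions can
    pass to J + f. Properness of the final quotient is checked separately. *)
Fixpoint regular J s : Prop :=
  if s is f :: s' then nzd J f /\ regular (adjoin J f) s' else True.

Lemma adjoin_gen J f s :
  ideal_gen (J `|` [set` f :: s]) = ideal_gen (adjoin J f `|` [set` s]).
Proof.
rewrite /adjoin ideal_gen_genU -setUA; congr (ideal_gen (_ `|` _)).
apply/seteqP; split=> [x|x [->|xs]]; rewrite /= inE ?eqxx //.
  by move=> /orP[/eqP|]; [left|right].
by move: xs => /= ->; rewrite orbT.
Qed.

Lemma regularP J s : is_ideal J ->
  regular J s <-> (forall i g, (i < size s)%N ->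
     ideal_gen (J `|` [set` take i s]) (g * s`_i) ->
     ideal_gen (J `|` [set` take i s]) g).
Proof.
have E0 (K : set R) : is_ideal K -> ideal_gen (K `|` [set` [::]]) = K.
  move=> Kid; rewrite (_ : _ `|` _ = K) ?ideal_gen_id //.
  by apply/seteqP; split=> x; [case|left].
elim: s J => [|f s IHs] J Jid //=; split.
  move=> [nf /(IHs _ (adjoin_ideal J f)) rs] [|i] g /=.
    by rewrite !E0 // => _; exact: nf.
  by rewrite ltnS adjoin_gen; exact: rs.
move=> rs; split.
  by move=> g; have := rs 0%N g isT; rewrite take0 /= !E0.
apply/(IHs _ (adjoin_ideal J f)) => i g lti.
by have := rs i.+1 g lti; rewrite /= adjoin_gen.
Qed.

Definition colon J u : set R := [set a | J (a * u)].

Lemma colon_ideal J u : is_ideal J -> is_ideal (colon J u).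
Proof.
move=> Jid; split=> [|x y Jx Jy|a x Jx]; rewrite /colon /= ?mul0r ?mulrDl -?mulrA.
- exact: ideal0.
- exact: idealD.
- exact: is_idealMl.
Qed.

(** Write g x = a z modulo J. Regularity of z modulo J + x gives a = b x modulo J, and cancelling x
    leaves g = b z. *)
Lemma nzd_swap J x z : is_ideal J -> nzd J x -> nzd J z -> nzd (adjoin J x) z ->
  nzd (adjoin J z) x.
Proof.
move=> Jid nx nz nzx g /adjoinE-/(_ Jid)[a Jgx].
have /nzx/adjoinE-/(_ Jid)[b Jab] : adjoin J x (a * z).
  apply/adjoinE => //; exists g; rewrite -opprB; exact: idealN.
apply/adjoinE => //; exists b; apply: nx.
have -> : (g - b * z) * x = (g * x - a * z) + (a - b * x) * z.
  by rewrite !mulrBl addrA subrK mulrAC.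
by apply: idealD => //; exact: is_idealMr.
Qed.

(** This vanishing of the socle (J : M)/J stands in for positive depth: a nonzerodivisor in M forces
    it, and over a Noetherian ring [exists_nzd] gives the converse. *)
Definition no_socle M J := forall u, (forall a, M a -> J (a * u)) -> J u.

Lemma nzd_no_socle M J f : is_ideal J -> M f -> nzd J f -> no_socle M J.
Proof. by move=> Jid Mf nf u Ju; apply: nf; rewrite mulrC; exact: Ju. Qed.

(* The socles of R/(J + x) and of R/(J + y) are isomorphic: if a u = y v for
   a in M and x u = y u', then u' represents the image of u. *)
Lemma no_socle_exchange M J x y : is_ideal J -> M x -> M y ->
  nzd J x -> nzd J y -> no_socle M (adjoin J x) -> no_socle M (adjoin J y).
Proof.
move=> Jid Mx My nx ny sx u My_u.
have /adjoinE-/(_ Jid)[u' Ju'] := My_u _ Mx.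
have /sx/adjoinE-/(_ Jid)[w Jw] : forall a, M a -> adjoin J x (a * u').
  move=> a /My_u/adjoinE-/(_ Jid)[v Jv]; apply/adjoinE => //; exists v; apply: ny.
  have -> : (a * u' - v * x) * y = (a * u - v * y) * x - a * (x * u - u' * y).
    by ring.
  by apply: idealB => //; [exact: is_idealMr|exact: is_idealMl].
apply/adjoinE => //; exists w; apply: nx.
have -> : (u - w * y) * x = (x * u - u' * y) + (u' - w * x) * y.
  by rewrite !mulrBl addrA subrK [u * x]mulrC mulrAC.
by apply: idealD => //; exact: is_idealMr.
Qed.

(** A product of elements outside a prime stays outside it, so one factor is taken from A and one
    from each listed ideal. *)
Lemma prime_pickN P (Is : seq (set R)) A : is_prime_ideal P -> is_ideal A -> ~ A `<=` P ->
  (forall I, I \in Is -> is_ideal I /\ ~ I `<=` P) ->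
  exists y, [/\ A y, ~ P y & forall I, I \in Is -> I y].
Proof.
move=> [_ P1 PM] Aid AP; elim: Is => [|I Is IHIs] IsP.
  by move/existsNP: AP => [y /not_implyP[Ay Py]]; exists y; split.
have [|y [Ay Py Isy]] := IHIs; first by move=> I' I'Is; apply: IsP; rewrite inE I'Is orbT.
have [Iid /existsNP[x /not_implyP[Ix Px]]] := IsP I (mem_head _ _).
exists (x * y); split; first exact: is_idealMl.
  by move=> /PM[].
move=> I'; rewrite inE => /orP[/eqP->|I'Is]; first exact: is_idealMr.
have [I'id _] := IsP I' (mem_behead (s := I :: Is) I'Is).
by apply: is_idealMl => //; exact: Isy.
Qed.

Lemma prime_avoidance A (Ps : seq (set R)) : is_ideal A ->
  (forall P, P \in Ps -> is_prime_ideal P /\ ~ A `<=` P) ->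
  exists2 x, A x & forall P, P \in Ps -> ~ P x.
Proof.
move=> Aid; have [d leP] := ubnP (size Ps).
elim: d Ps leP => // d IHd [|P Ps] /= leP PsP; first by exists 0; first exact: ideal0.
have [Ppr AP] := PsP P (mem_head _ _).
have PsP' Q : Q \in Ps -> is_prime_ideal Q /\ ~ A `<=` Q.
  by move=> QPs; apply: PsP; rewrite inE QPs orbT.
have [[Q [QPs QP]]|nsub] := pselect (exists Q, Q \in Ps /\ Q `<=` P).
  have [||x Ax Psx] := IHd (P :: rem Q Ps).
  - rewrite /= size_rem // prednK //; last by case: (Ps) QPs.
  - by move=> P'; rewrite inE => /orP[/eqP->//|/mem_rem/PsP'].
  exists x => // P' P'in P'x.
  have [P'r|P'r] := boolP (P' \in P :: rem Q Ps); first exact: Psx P'r P'x.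
  have P'Q : P' = Q.
    move: P'in P'r; rewrite !inE (perm_mem (perm_to_rem QPs)) inE.
    by case/or3P => [->//|/eqP//|->]; rewrite orbT.
  by apply: (Psx P (mem_head _ _)); apply: QP; rewrite -P'Q.
have [x Ax Psx] := IHd Ps leP PsP'.
have [Px|Px] := pselect (P x); last first.
  by exists x => // Q; rewrite inE => /orP[/eqP->|/Psx].
(* When x lies in P, it is corrected by an element of A that lies in all the other primes but not in
   P. *)
have [|y [Ay Py Psy]] := @prime_pickN P Ps A Ppr Aid AP.
  move=> I IPs; have [[? _ _] _] := PsP' I IPs; split=> // IP.
  by apply: nsub; exists I.
exists (x + y); first exact: idealD.
move=> Q; rewrite inE => /orP[/eqP->|QPs] xy.
  by apply: Py; rewrite -(addrK x y) addrC addrC (addrC y); apply: idealB => //; case: Ppr.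
apply: (Psx Q QPs); rewrite -(addrK y x); apply: idealB => //; last exact: Psy.
by have [[]] := PsP' Q QPs.
Qed.

(** Stated for arbitrary subsets, with the generators taken from A itself: [max_annihilator_finite]
    needs generators that still have the property defining A. *)
Definition noetherian :=
  forall A, exists2 s : seq R, [set` s] `<=` A & A `<=` ideal_gen [set` s].

(** Without a maximal member, choice builds a strictly ascending chain above A; finitely many
    generators of its union already lie in one term, where the chain must stop. *)
Lemma noetherian_max (F : set (set R)) A : noetherian ->
  (forall B, F B -> is_ideal B) -> F A ->
  exists M, [/\ F M, A `<=` M & forall B, F B -> M `<=` B -> B `<=` M].
Proof.
move=> noeR Fid FA; apply: contrapT => noM.
have /choice[next nextP] (B : set R) :
    exists B', F B -> A `<=` B -> [/\ F B', B `<=` B' & ~ B' `<=` B].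
  have [[FB AB]|] := pselect (F B /\ A `<=` B); last first.
    by move=> nFB; exists B => FB AB; case: nFB.
  apply: contrapT => /forallNP noB; apply: noM; exists B; split=> // B' FB' BB'.
  by apply: contrapT => B'B; apply: (noB B').
pose M k := iter k next A.
have FM k : F (M k) /\ A `<=` M k.
  elim: k => [|k [FMk AMk]]; first by split.
  by have [? MM _] := nextP _ FMk AMk; split=> //; exact: subset_trans AMk MM.
have MS k : M k `<=` M k.+1 by have [FMk AMk] := FM k; have [] := nextP _ FMk AMk.
have Mmono j k : (j <= k)%N -> M j `<=` M k.
  move=> /subnK <-; elim: (k - j)%N => [//|i IHi].
  exact: subset_trans IHi (MS _).
have [s sM Ms] := noeR [set x | exists k, M k x].
have [k sMk] : exists k, [set` s] `<=` M k.
  elim: s sM {Ms} => [|x s IHs] sM; first by exists 0%N.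
  have [|k sk] := IHs; first by move=> y ys; apply: sM; rewrite /= inE ys orbT.
  have [j xj] := sM x (mem_head _ _).
  exists (maxn j k) => y /=; rewrite inE => /orP[/eqP->|ys].
    exact: Mmono (leq_maxl _ _) _ xj.
  by apply: Mmono (leq_maxr j k) _ _; exact: sk.
have [FMk AMk] := FM k; have [_ _] := nextP _ FMk AMk; apply=> x Mx.
apply: (@ideal_gen_min _ _ _ (Fid _ FMk) sMk); apply: Ms; by exists k.+1.
Qed.

Definition annihilators J : set (set R) := [set P | exists2 u, ~ J u & P = colon J u].

(** These are associated primes of R/J. They are finitely many and cover the zero divisors, which is
    what prime avoidance requires. *)
Definition max_annihilator J P :=
  annihilators J P /\ forall Q, annihilators J Q -> P `<=` Q -> Q `<=` P.

(** If x y u lies in J and y u does not, then (J : y u) contains (J : u), hence equals it by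
    maximality, and contains x. *)
Lemma max_annihilator_prime J P :
  is_ideal J -> max_annihilator J P -> is_prime_ideal P.
Proof.
move=> Jid [[u Ju ->] maxP]; split; first exact: colon_ideal.
  by rewrite /colon /= mul1r.
move=> x y; rewrite /colon /= => Jxyu.
have [|Jyu] := pselect (J (y * u)); [by right|left].
apply: (maxP (colon J (y * u))); first by exists (y * u).
  by move=> z; rewrite /colon /= mulrCA => Jz; exact: is_idealMl.
by rewrite /colon /= mulrA.
Qed.

Lemma zero_divisor_max_annihilator J f : noetherian -> is_ideal J -> ~ nzd J f ->
  exists2 P, max_annihilator J P & P f.
Proof.
move=> noeR Jid /existsNP[g /not_implyP[Jgf Jg]].
have [||M [FM gM maxM]] := @noetherian_max (annihilators J) (colon J g) noeR.
- by move=> _ [u _ ->]; exact: colon_ideal.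
- by exists g.
by exists M => //; apply: gM; rewrite /colon /= mulrC.
Qed.

(* The elements u with maximal annihilator generate a finitely generated
   ideal; if s generates it then the intersection of the (J : v), v in s, is
   contained in every (J : u), so some (J : v) is, hence equals it. *)
Lemma max_annihilator_finite J : noetherian -> is_ideal J ->
  exists2 Ps : seq (set R), forall P, P \in Ps -> max_annihilator J P
    & forall P, max_annihilator J P -> P \in Ps.
Proof.
move=> noeR Jid.
have [s sA As] := noeR [set u | max_annihilator J (colon J u)].
exists [seq colon J v | v <- s].
  by move=> _ /mapP[v vs ->]; exact: sA.
move=> P Pmax; have Ppr := max_annihilator_prime Jid Pmax.
have [[u Ju Pu] maxP] := Pmax.
apply: contrapT => /negP PNs.
have [|||y [_ Py sy]] := @prime_pickN P [seq colon J v | v <- s] setT Ppr.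
- by split.
- by case: Ppr => _ P1 _; move=> /(_ 1 I).
- move=> _ /mapP[v vs ->]; split; first exact: colon_ideal.
  move=> sub; have [annv maxv] := sA v vs.
  suff Pv : P = colon J v by rewrite Pv map_f in PNs.
  apply/seteqP; split=> //.
  by apply: maxv => //; exists u.
have /As su : max_annihilator J (colon J u) by rewrite -Pu.
apply: Py; rewrite Pu /colon /=; move: u su {Ju Pu}.
apply: ideal_gen_ind.
- by rewrite mulr0; exact: ideal0.
- by move=> a b Ja Jb; rewrite mulrDr; exact: idealD.
- by move=> a b Jb; rewrite mulrCA; exact: is_idealMl.
- by move=> v vs; apply: (sy (colon J v)); exact: map_f.
Qed.

(** Prime avoidance is applied to the preimages under phi of the maximal annihilators of all the J
    at once. None of these preimages contains M: otherwise M would lie in some (J : u) with u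
    outside J, against [no_socle]. *)
Lemma exists_nzd (M : set R) (phi : {rmorphism R -> R}) (Js : seq (set R)) :
  noetherian -> is_ideal M ->
  (forall P, is_prime_ideal P -> (forall a, M a -> P (phi a)) -> M `<=` P) ->
  (forall J, J \in Js -> is_ideal J /\ no_socle M J) ->
  exists2 g, M g & forall J, J \in Js -> nzd J (phi g).
Proof.
move=> noeR Mid phiM JsP.
have [Ps PsP Jsz] : exists2 Ps : seq (set R),
    forall P, P \in Ps -> is_prime_ideal P /\ ~ M `<=` P &
    forall J f, J \in Js -> ~ nzd J f -> exists2 P, P \in Ps & P f.
  elim: Js JsP => [|J Js IHJs] JsP; first by exists [::].
  have [|Ps PsP Jsz] := IHJs; first by move=> J' J'in; apply: JsP; rewrite inE J'in orbT.
  have [Jid Jsoc] := JsP J (mem_head _ _).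
  have [Qs QsP Jz] := max_annihilator_finite noeR Jid.
  exists (Qs ++ Ps).
    move=> P; rewrite mem_cat => /orP[/QsP Pmax|/PsP//].
    split; first exact: max_annihilator_prime Pmax.
    by have [[u Ju ->] _] := Pmax => Mu; apply: Ju; apply: Jsoc.
  move=> J' f; rewrite inE => /orP[/eqP->|J'in] nJf.
    have [P /Jz PQs Pf] := zero_divisor_max_annihilator noeR Jid nJf.
    by exists P; rewrite // mem_cat PQs.
  have [P PPs Pf] := Jsz J' f J'in nJf.
  by exists P; rewrite // mem_cat PPs orbT.
have [||g Mg Pg] := @prime_avoidance M [seq phi @^-1` P | P <- Ps] => //.
  move=> _ /mapP[P /PsP[Ppr MP] ->]; have [Pid P1 PM] := Ppr.
  split; last by move=> sub; apply: MP; exact: phiM.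
  split; first split.
  - by rewrite /preimage /= rmorph0; exact: ideal0.
  - by move=> x y Px Py; rewrite /preimage /= rmorphD; exact: idealD.
  - by move=> a x Px; rewrite /preimage /= rmorphM; exact: is_idealMl.
  - by rewrite /preimage /= rmorph1.
  - by move=> x y; rewrite /preimage /= rmorphM; exact: PM.
exists g => // J Jin; apply: contrapT => /(Jsz J _ Jin)[P PPs Pf].
exact: Pg (map_f _ PPs) Pf.
Qed.

(** Induction on the length, through an auxiliary z that is regular modulo J, J + x and J + y. The
    sequence x, x2, s becomes x, z, s3, then z, x, s3, then z, y, s4, and finally y, z, s4. *)
Lemma regular_exchange M J x y s : noetherian -> is_ideal M -> is_ideal J ->
  regular J (x :: s) -> [set` x :: s] `<=` M -> M y -> nzd J y ->
  exists s', [/\ size s' = size s, [set` s'] `<=` M & regular (adjoin J y) s'].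
Proof.
move=> noeR Mid; have [d] := ubnP (size s).
elim: d J x y s => // d IHd J x y [|x2 s] leP Jid [nx rs] sM My ny.
  by exists [::]; split.
have Mx : M x by apply: sM; rewrite /= mem_head.
have sM' : [set` x2 :: s] `<=` M by move=> z zs; apply: sM; rewrite /= inE zs orbT.
have Mx2 : M x2 by apply: sM'; rewrite /= mem_head.
have [nx2 _] := rs.
have socx := nzd_no_socle (adjoin_ideal J x) Mx2 nx2.
have [||z Mz zP] := @exists_nzd M idfun [:: J; adjoin J x; adjoin J y] noeR Mid.
- by [].
- move=> J'; rewrite !inE => /or3P[]/eqP->; split=> //.
    exact: nzd_no_socle nx.
  exact: no_socle_exchange socx.
have nz : nzd J z by apply: (zP J); rewrite mem_head.
have nzx : nzd (adjoin J x) z by apply: (zP (adjoin J x)); rewrite !inE eqxx orbT.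
have nzy : nzd (adjoin J y) z by apply: (zP (adjoin J y)); rewrite !inE eqxx !orbT.
(* Modulo J + x, the element z replaces x2. *)
have [s3 [sz3 s3M r3]] := IHd (adjoin J x) x2 z s leP (adjoin_ideal J x) rs sM' Mz nzx.
(* Modulo J + z, the element y replaces x. *)
have [||||||s4 [sz4 s4M r4]] := IHd (adjoin J z) x y s3 => //.
- by rewrite sz3.
- by split; [exact: nzd_swap|rewrite adjoinC].
- by move=> w /=; rewrite inE => /orP[/eqP->|/s3M].
- exact: nzd_swap.
exists (z :: s4); split; first by rewrite /= sz4 sz3.
  by move=> w /=; rewrite inE => /orP[/eqP->|/s4M].
by split=> //; rewrite adjoinC.
Qed.

(** A nonzerodivisor of the form phi g replaces the head of the sequence by exchange, and the
    induction continues modulo J + phi g. *)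
Lemma regular_image M (phi : {rmorphism R -> R}) J s : noetherian -> is_ideal M ->
  (forall P, is_prime_ideal P -> (forall a, M a -> P (phi a)) -> M `<=` P) ->
  (forall a, M a -> M (phi a)) ->
  is_ideal J -> regular J s -> [set` s] `<=` M ->
  exists t, [/\ size t = size s, [set` t] `<=` M & regular J [seq phi g | g <- t]].
Proof.
move=> noeR Mid phiP phiM; have [d] := ubnP (size s).
elim: d J s => // d IHd J [|x s] leP Jid rs sM; first by exists [::]; split.
have [nx _] := rs; have Mx : M x by apply: sM; rewrite /= mem_head.
have [|g Mg gP] := @exists_nzd M phi [:: J] noeR Mid phiP.
  by move=> J'; rewrite inE => /eqP->; split=> //; exact: nzd_no_socle nx.
have ng : nzd J (phi g) by apply: gP; rewrite inE.
have [s' [sz' s'M r']] := regular_exchange noeR Mid Jid rs sM (phiM _ Mg) ng.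
have [|t [szt tM rt]] := IHd (adjoin J (phi g)) s' _ (adjoin_ideal J _) r' s'M.
- by rewrite sz'.
exists (g :: t); split=> //=; first by rewrite szt sz'.
by move=> w /=; rewrite inE => /orP[/eqP->|/tM].
Qed.

(* phi makes R a module over itself of which R/J1 is a direct summand modulo
   J2, with retraction rho: adjoining g to J1 corresponds to adjoining phi g to
   J2. *)
Lemma regular_retract (phi : {rmorphism R -> R}) (rho : {additive R -> R}) J1 J2 s :
  (forall f h, rho (phi f * h) = f * rho h) -> rho 1 = 1 ->
  is_ideal J1 -> is_ideal J2 ->
  (forall x, J1 x -> J2 (phi x)) -> (forall x, J2 x -> J1 (rho x)) ->
  regular J2 [seq phi g | g <- s] -> regular J1 s.
Proof.
move=> rhoM rho1; elim: s J1 J2 => //= g s IHs J1 J2 id1 id2 J12 J21 [ng rs].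
have rhoK x : rho (phi x) = x by rewrite -[phi x]mulr1 rhoM rho1 mulr1.
split.
  move=> h /J12; rewrite rmorphM => /ng/J21; by rewrite rhoK.
apply: IHs rs => // x /adjoinE.
  move=> /(_ id1)[a /J12]; rewrite rmorphB rmorphM => Ja.
  by apply/adjoinE => //; exists (phi a).
move=> /(_ id2)[a /J21]; rewrite raddfB [a * _]mulrC rhoM => Ja.
by apply/adjoinE => //; exists (rho a); rewrite [rho a * _]mulrC.
Qed.

End IdealTheory.

(** * Monomial ideals *)

(** Induction on the number of compared coordinates. When one more is compared, the previous list
    serves all exponents that are at least N there, N bounding that coordinate on the list; each of
    the finitely many slices below N gets its own list. *)
Lemma dickson n (E : set 'X_{1..n}) :
  exists2 s : seq 'X_{1..n}, [set` s] `<=` E &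
    forall u, E u -> exists2 v, v \in s & (v <= u)%MM.
Proof.
suff gen k : (k <= n)%N -> exists2 s : seq 'X_{1..n}, [set` s] `<=` E &
    forall u, E u -> exists2 v, v \in s & forall i : 'I_n, (i < k)%N -> (v i <= u i)%N.
  have [s sE sP] := gen n (leqnn n).
  by exists s => // u /sP[v vs vu]; exists v => //; apply/mnm_lepP => i; exact: vu.
elim: k E => [|k IHk] E lekn.
  have [[u Eu]|E0] := pselect (exists u, E u).
    exists [:: u] => [v /=|v Ev]; first by rewrite inE => /eqP->.
    by exists u; rewrite ?mem_head.
  by exists [::] => // u Eu; case: E0; exists u.
have [s sE sP] := IHk E (ltnW lekn).
pose i0 := Ordinal lekn; pose N := \max_(v <- s) v i0.
have /choice[t tP] (j : nat) : exists t : seq 'X_{1..n}, [set` t] `<=` [set u | E u /\ u i0 = j] /\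
    forall u, E u -> u i0 = j ->
      exists2 v, v \in t & forall i : 'I_n, (i < k)%N -> (v i <= u i)%N.
  have [t tE tP] := IHk [set u | E u /\ u i0 = j] (ltnW lekn).
  by exists t; split=> // u Eu uj; apply: tP.
exists (s ++ flatten [seq t j | j <- iota 0 N]).
  move=> u /=; rewrite mem_cat => /orP[/sE//|/flatten_mapP[j _]].
  by have [tE _] := tP j; move=> /tE[].
move=> u Eu; have [leN|ltN] := leqP N (u i0).
  have [v vs vu] := sP u Eu; exists v; first by rewrite mem_cat vs.
  move=> i; rewrite ltnS leq_eqVlt => /orP[/eqP ik|/vu//].
  have -> : i = i0 by exact: val_inj.
  by apply: leq_trans leN; exact: (leq_bigmax_seq (P := xpredT)).
have [tE /(_ u Eu erefl)[v vt vu]] := tP (u i0); exists v.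
  rewrite mem_cat; apply/orP; right; apply/flatten_mapP; exists (u i0) => //.
  by rewrite mem_iota.
move=> i; rewrite ltnS leq_eqVlt => /orP[/eqP ik|/vu//].
have -> : i = i0 by exact: val_inj.
by have [_ ->] := tE _ vt.
Qed.

Section Monomial.
Variables (K : fieldType) (n : nat).
Local Notation S := {mpoly K[n]}.
Implicit Types (E F : set 'X_{1..n}) (u v : 'X_{1..n}) (f g : S).

(** Dickson's lemma gives finitely many elements h v whose leading exponents generate those of the
    ideal; division by them, by induction on the leading exponent, shows that they generate the
    ideal. *)
Theorem mpoly_noetherian : noetherian S.
Proof.
move=> A; set B := ideal_gen A; have Bid : is_ideal B by exact: ideal_genP.
have [s sE sP] := dickson [set mlead f | f in [set f | B f /\ f != 0]].
have /choice[h hP] (v : 'X_{1..n}) : exists h : S, v \in s -> [/\ B h, h != 0 & mlead h = v].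
  have [/sE[h [Bh h0] hv]|_] := boolP (v \in s); last by exists 0.
  by exists h.
(* The generators have to come from A, so each h v is traced back to finitely many elements of A. *)
have /choice[t tP] (v : 'X_{1..n}) :
    exists t : seq S, v \in s -> [set` t] `<=` A /\ ideal_gen [set` t] (h v).
  have [/hP[Bh _ _]|_] := boolP (v \in s); last by exists [::].
  by have [t tA th] := ideal_gen_finite Bh; exists t.
pose r := flatten [seq t v | v <- s].
exists r.
  by move=> f /= /flatten_mapP[v vs ftv]; have [tA _] := tP v vs; exact: tA.
have Cid : is_ideal (ideal_gen [set` r]) by exact: ideal_genP.
have hC v : v \in s -> ideal_gen [set` r] (h v).
  move=> vs; have [_ th] := tP v vs; apply: (ideal_gen_mono _ th) => f /= ft.
  by apply/flatten_mapP; exists v.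
suff BC f : B f -> ideal_gen [set` r] f by move=> f Af; apply: BC; exact: sub_ideal_gen.
move: {2}(mlead f) (erefl (mlead f)) => m; elim/(@ltmwf n): m f => m IHm f fm Bf.
have [->|f0] := eqVneq f 0; first exact: ideal0 Cid.
have [v vs vf] : exists2 v, v \in s & (v <= mlead f)%MM by apply: sP; exists f.
have [Bh h0 hv] := hP v vs.
pose c := mleadc f / mleadc (h v).
(* The term q is chosen so that q * h v has the same leading term as f. *)
pose q : S := c *: 'X_[mlead f - v].
have c0 : c != 0 by rewrite mulf_neq0 ?invr_eq0 ?mleadc_eq0.
have lq : mlead q = (mlead f - v)%MM by rewrite mleadZ // mleadXm.
have q0 : q != 0 by rewrite -mleadc_eq0 lq mcoeffZ mcoeffX eqxx mulr1.
have lqh : mlead (q * h v) = mlead f by rewrite mleadM // lq hv submK.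
have Cq : ideal_gen [set` r] (q * h v) by apply: (is_idealMl _ Cid); exact: hC.
apply: (idealBl Cid _ Cq).
have [->|g0] := eqVneq (f - q * h v) 0; first exact: ideal0 Cid.
apply: (IHm (mlead (f - q * h v))) => //; last first.
  by apply: (idealB Bid) => //; exact: (is_idealMl _ Bid).
rewrite -fm lt_neqAle; apply/andP; split; last first.
  by rewrite (le_trans (mleadB_le _ _)) // lqh joinxx.
have cqh : (q * h v)@_(mlead f) = mleadc f.
  rewrite -{1}lqh mleadM // mleadcM lq mcoeffZ mcoeffX eqxx mulr1 mulfVK //.
  by rewrite mleadc_eq0.
by apply/eqP => lg; move: g0; rewrite -mleadc_eq0 lg mcoeffB cqh subrr eqxx.
Qed.

Definition monomial_span E : set S := ideal_gen [set 'X_[u] | u in E].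

Lemma monomial_spanP E f :
  monomial_span E f <-> forall m, m \in msupp f -> exists2 u, E u & (u <= m)%MM.
Proof.
split=> [|Ef]; last first.
  rewrite (mpolyE f) big_seq; have Eid : is_ideal (monomial_span E) by exact: ideal_genP.
  apply: (ideal_sum _ Eid) => m /Ef[u Eu um]; rewrite -mul_mpolyC -(submK um) mpolyXD mulrA.
  by apply: (is_idealMl _ Eid); apply: sub_ideal_gen; exists u.
move: f; apply: ideal_gen_ind.
- by move=> m; rewrite msupp0.
- by move=> f g Ef Eg m /msuppD_le; rewrite mem_cat => /orP[/Ef|/Eg].
- move=> f g Eg _ /msuppM_le/allpairsP[[m1 m2] [_ /Eg[u Eu um] ->]]; exists u => //=.
  exact: lepm_trans um (lem_addl _ _).
- by move=> _ [u Eu <-] m; rewrite msuppX inE => /eqP->; exists u => //; exact: lepm_refl.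
Qed.

Lemma monomial_spanX E u :
  monomial_span E 'X_[u] <-> exists2 v, E v & (v <= u)%MM.
Proof.
rewrite monomial_spanP; split=> [Eu|Eu m]; last by rewrite msuppX inE => /eqP->.
by apply: Eu; rewrite msuppX mem_head.
Qed.

Lemma monomial_span_supp E f :
  monomial_span E f <-> forall m, m \in msupp f -> monomial_span E 'X_[m].
Proof.
by rewrite monomial_spanP; split=> Ef m /Ef; rewrite monomial_spanX.
Qed.

Lemma lepm_add u v u' v' : (u <= u' -> v <= v' -> u + v <= u' + v')%MM.
Proof.
move=> /mnm_lepP uu' /mnm_lepP vv'; apply/mnm_lepP => i; rewrite !mnmDE.
exact: leq_add.
Qed.

Lemma monomial_span_prod E F :
  ideal_prod (monomial_span E) (monomial_span F) =
  monomial_span [set (u + v)%MM | u in E & v in F].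
Proof.
apply/seteqP; split; apply: ideal_gen_min; try exact: ideal_genP.
  move=> _ [f [g [/monomial_spanP Ef /monomial_spanP Fg ->]]]; apply/monomial_spanP.
  move=> _ /msuppM_le/allpairsP[[m1 m2] /= [/Ef[u Eu um] /Fg[v Fv vm] ->]].
  by exists (u + v)%MM; [exists u => //; exists v|exact: lepm_add].
move=> _ [_ [u Eu [v Fv <-]] <-]; apply: sub_ideal_gen.
exists 'X_[u], 'X_[v]; split; rewrite ?mpolyXD //.
  by apply: sub_ideal_gen; exists u.
by apply: sub_ideal_gen; exists v.
Qed.

Fixpoint sumset E k : set 'X_{1..n} :=
  if k is k'.+1 then [set (u + v)%MM | u in E & v in sumset E k'] else [set 0%MM].

Lemma monomial_span_pow E k :
  ideal_pow (monomial_span E) k = monomial_span (sumset E k).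
Proof.
elim: k => [|k IHk]; last by rewrite /= IHk monomial_span_prod.
apply/seteqP; split=> // f _; apply/monomial_spanP => m _; exists 0%MM => //.
by apply/mnm_lepP => i; rewrite mnm0E.
Qed.

Lemma sumsetD E i j u v :
  sumset E i u -> sumset E j v -> sumset E (i + j) (u + v)%MM.
Proof.
elim: i u => [|i IHi] u /=; first by move=> ->; rewrite add0m.
move=> [a Ea [b sb <-]] sv; exists a => //; exists (b + v)%MM; first exact: IHi.
by rewrite addmA.
Qed.

Lemma sumset_mulmn E k u j : sumset E k u -> sumset E (k * j) (u *+ j)%MM.
Proof.
move=> sku; elim: j => [|j IHj]; first by rewrite muln0 mulm0n.
by rewrite mulnS mulmS; exact: sumsetD.
Qed.

Lemma monomial_ideal_finite (I : set S) : is_monomial_ideal I ->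
  exists B : seq 'X_{1..n}, I = monomial_span [set` B].
Proof.
move=> [G ->]; have [B BG GB] := dickson G; exists B.
apply/seteqP; split; apply: ideal_gen_min; try exact: ideal_genP.
  by move=> _ [u /GB uB <-]; apply/monomial_spanX; case: uB => v; exists v.
by move=> _ [u /BG Gu <-]; apply: sub_ideal_gen; exists u.
Qed.

End Monomial.

(** * Depth and the power map *)

(** [supremum] takes its default value when there is no least upper bound, so existence is needed: a
    maximum for a bounded set, +oo for an unbounded one. *)
Lemma supremums_nat (A : set nat) : A !=set0 ->
  supremums [set (d%:Z)%:E | d in A] !=set0.
Proof.
move=> [a Aa]; have [[N AN]|unb] := pselect (exists N, forall d, A d -> (d <= N)%N).
  have exA : exists d, `[< A d >] by exists a; apply/asboolP.
  have ubA d : `[< A d >] -> (d <= N)%N by move=> /asboolP; exact: AN.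
  case: (ex_maxnP exA ubA) => M /asboolP AM maxM.
  exists (M%:Z)%:E; split; last by move=> y; apply; exists M.
  by move=> _ [d /asboolP/maxM dM <-]; rewrite lee_fin lez_nat.
exists +oo%E; split; first by move=> y _; rewrite leey.
move=> [r| |] ubr; rewrite ?leexx //; last by have := ubr _ (imageP _ Aa).
case: unb; exists `|r|%N => d Ad; have := ubr _ (imageP _ Ad); rewrite lee_fin.
by lia.
Qed.

Lemma le_supremum_nat (A : set nat) d : A d ->
  ((d%:Z)%:E <= supremum -oo%E [set (d%:Z)%:E | d in A])%E.
Proof.
move=> Ad; apply: ge_supremum_Nmem; last by exists d.
by apply: supremums_nat; exists d.
Qed.

Lemma supremum_nat_mono (A B : set nat) : A `<=` B ->
  (supremum -oo%E [set (d%:Z)%:E | d in A] <=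
   supremum -oo%E [set (d%:Z)%:E | d in B])%E.
Proof.
move=> AB; have [->|/set0P A0] := eqVneq A set0; first by rewrite image_set0 supremum0 leNye.
rewrite {1}/supremum; case: ifPn => [_|_]; first by rewrite leNye.
case: xgetP => [x _ [_ lub]|nosup]; last by have [x /nosup] := supremums_nat A0.
apply: lub => _ [d Ad <-].
exact: le_supremum_nat (AB _ Ad).
Qed.

Section PowerMap.
Variables (K : fieldType) (n q : nat).
Hypothesis q_gt0 : (0 < q)%N.
Local Notation S := {mpoly K[n]}.
Implicit Types (f g h : S) (u v m : 'X_{1..n}).

Definition power_map : S -> S := comp_mpoly [tuple ('X_i ^+ q : S) | i < n].
HB.instance Definition _ := GRing.RMorphism.on power_map.

Lemma power_mapX m : power_map 'X_[m] = 'X_[m *+ q].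
Proof.
rewrite /power_map comp_mpolyX [RHS]mpolyXE_id; apply: eq_bigr => i _.
by rewrite tnth_mktuple -exprM mulmnE mulnC.
Qed.

Lemma power_mapZ c f : power_map (c *: f) = c *: power_map f.
Proof. exact: comp_mpolyZ. Qed.

Definition mnm_div m : 'X_{1..n} := [multinom (m i %/ q)%N | i < n].

Lemma mnm_mulK : cancel (fun m => m *+ q)%MM mnm_div.
Proof. by move=> m; apply/mnmP => i; rewrite mnmE mulmnE mulnK. Qed.

(** The retraction of [power_map], linear over S when S acts through [power_map]: terms whose
    exponent is not a multiple of q are discarded. *)
Definition root_map f : S :=
  \sum_(m <- msupp f | (mnm_div m *+ q)%MM == m) f@_m *: 'X_[mnm_div m].

Lemma mcoeff_root_map f u : (root_map f)@_u = f@_(u *+ q).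
Proof.
rewrite /root_map [X in _ = X@__]mpolyE !raddf_sum /= big_mkcond /=; apply: eq_bigr => m _.
rewrite [RHS]mcoeffZ mcoeffX; case: ifPn => [/eqP mE|mE].
  rewrite mcoeffZ mcoeffX; congr (_ * (nat_of_bool _)%:R).
  by apply/eqP/eqP => [<-|->]; [rewrite mE|rewrite mnm_mulK].
case: eqP => [mE'|]; last by rewrite mulr0.
by move: mE; rewrite mE' mnm_mulK eqxx.
Qed.

Lemma root_map_is_zmod_morphism : zmod_morphism root_map.
Proof. by move=> f g; apply/mpolyP => u; rewrite mcoeffB !mcoeff_root_map mcoeffB. Qed.
HB.instance Definition _ :=
  GRing.isZmodMorphism.Build S S root_map root_map_is_zmod_morphism.

Lemma root_mapZ c f : root_map (c *: f) = c *: root_map f.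
Proof. by apply/mpolyP => u; rewrite mcoeffZ !mcoeff_root_map mcoeffZ. Qed.

Lemma mcoeffXM m f u : ('X_[m] * f)@_u = if (m <= u)%MM then f@_(u - m) else 0.
Proof.
case: ifPn => [mu|mu]; first by rewrite mulrC -{1}(submK mu) addmC mcoeffMX.
apply/eqP; rewrite mcoeff_eq0; apply: contra mu => /msuppM_le/allpairsP[[a b] /=].
by rewrite msuppX inE => -[/eqP-> _ ->]; exact: lem_addr.
Qed.

Lemma root_mapM f h : root_map (power_map f * h) = f * root_map h.
Proof.
rewrite {1}(mpolyE f) [X in _ = X * _](mpolyE f) raddf_sum /= !mulr_suml raddf_sum /=.
apply: eq_bigr => m _; rewrite power_mapZ power_mapX -!scalerAl root_mapZ; congr (_ *: _).
apply/mpolyP => u; rewrite mcoeff_root_map !mcoeffXM.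
have -> : (m *+ q <= u *+ q)%MM = (m <= u)%MM.
  by apply/mnm_lepP/mnm_lepP => le i; have := le i; rewrite !mulmnE leq_pmul2r.
case: ifP => // _; rewrite mcoeff_root_map; congr (_ @_ _).
by apply/mnmP => i; rewrite !(mulmnE, mnmBE) mulnBl.
Qed.

Lemma root_map1 : root_map 1 = 1.
Proof.
apply/mpolyP => u; rewrite mcoeff_root_map !mcoeff1.
congr ((nat_of_bool _)%:R); apply/eqP/eqP => [u0|->]; last first.
  by apply/mnmP => i; rewrite mulmnE !mnm0E.
apply: (can_inj mnm_mulK); rewrite u0.
by apply/mnmP => i; rewrite mulmnE !mnm0E.
Qed.

(** A prime containing x_i^q contains x_i. This is the condition on phi in [regular_image]. *)
Lemma max_ideal_sub_prime (P : set S) : is_prime_ideal P ->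
  (forall f, max_ideal f -> P (power_map f)) -> max_ideal `<=` P.
Proof.
move=> [Pid P1 PM] Pphi; apply: ideal_gen_min => // _ [i _ <-].
have : P ('X_i ^+ q).
  have := Pphi 'X_i; rewrite power_mapX -mpolyXn; apply.
  by apply: sub_ideal_gen; exists i.
elim: q {Pphi} => [|k IHk]; first by rewrite expr0.
by rewrite exprS => /PM[].
Qed.

Lemma power_map_max_ideal f : max_ideal f -> max_ideal (power_map f).
Proof.
have Mid : is_ideal (@max_ideal K n) by exact: ideal_genP.
move: f; apply: ideal_gen_ind.
- by rewrite rmorph0; exact: ideal0.
- by move=> f g; rewrite rmorphD; exact: (idealD Mid).
- by move=> f g; rewrite rmorphM; exact: (is_idealMl _ Mid).
- move=> _ [i _ <-]; rewrite power_mapX -mpolyXn -(prednK q_gt0) exprS.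
  by apply: (is_idealMr _ Mid); apply: sub_ideal_gen; exists i.
Qed.

Lemma monomial_sub_max_ideal (E : set 'X_{1..n}) :
  (monomial_span E : set S) <> setT -> monomial_span E `<=` @max_ideal K n.
Proof.
have Mid : is_ideal (@max_ideal K n) by exact: ideal_genP.
move=> ET; apply: ideal_gen_min => // _ [u Eu <-].
have [u0|/forallPn[i ui]] := boolP [forall i, u i == 0%N].
  case: ET; apply/seteqP; split=> // f _; apply/monomial_spanP => m _; exists u => //.
  by apply/mnm_lepP => i; have /forallP/(_ i)/eqP-> := u0.
rewrite -(@submK _ U_(i)%MM u); last by rewrite lep1mP.
by rewrite mpolyXD; apply: (is_idealMl _ Mid); apply: sub_ideal_gen; exists i.
Qed.

Lemma depth_quot_power (E1 E2 : set 'X_{1..n}) :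
  (forall u, monomial_span E1 ('X_[u] : S) <-> monomial_span E2 ('X_[u *+ q] : S)) ->
  (depth_quot max_ideal (monomial_span E2 : set S) <=
   depth_quot max_ideal (monomial_span E1 : set S))%E.
Proof.
move=> E12; set J1 : set S := monomial_span E1; set J2 : set S := monomial_span E2.
have id1 : is_ideal J1 by exact: ideal_genP.
have id2 : is_ideal J2 by exact: ideal_genP.
have Mid : is_ideal (@max_ideal K n) by exact: ideal_genP.
(* The unit ideal has infinite depth; if J2 is the unit ideal, the hypothesis for u = 0 shows that
   J1 is too. *)
rewrite /depth_quot; case: asboolP => [J2T|J2T]; case: asboolP => J1T; rewrite ?leey //.
  have /E12 : J2 ('X_[0 *+ q]) by rewrite J2T.
  rewrite mpolyX0 => J11; case: J1T; apply/seteqP; split=> // f _.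
  by rewrite -[f]mulr1; exact: (is_idealMl _ id1).
rewrite -(image_comp (fun f : seq S => size f) (fun d => (d%:Z)%:E)).
rewrite -(image_comp (fun f : seq S => size f) (fun d => (d%:Z)%:E)).
apply: supremum_nat_mono => _ [f [fM [rf _]] <-].
have [|||||||g [gsz gM rg]] := @regular_image _ max_ideal power_map J2 f => //.
- exact: mpoly_noetherian.
- exact: max_ideal_sub_prime.
- exact: power_map_max_ideal.
- exact/regularP.
have J12 x : J1 x -> J2 (power_map x).
  move: x; apply: ideal_gen_ind.
  - by rewrite rmorph0; exact: ideal0.
  - by move=> x y; rewrite rmorphD; exact: (idealD id2).
  - by move=> a x; rewrite rmorphM; exact: (is_idealMl _ id2).
  - move=> _ [u Eu <-]; rewrite power_mapX; apply/E12.
    by apply: sub_ideal_gen; exists u.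
have J21 x : J2 x -> J1 (root_map x).
  move=> /monomial_span_supp J2x; apply/monomial_span_supp => m.
  by rewrite mcoeff_msupp mcoeff_root_map -mcoeff_msupp => /J2x/E12.
exists g => //; split=> //; split.
  apply/regularP => //.
  exact: (regular_retract (phi := power_map) (rho := root_map) root_mapM root_map1
            id1 id2 J12 J21 rg).
(* Properness: J1 and the elements of g all lie in the maximal ideal. *)
move=> gT; have : max_ideal (1 : S).
  have : ideal_gen (J1 `|` [set` g]) 1 by rewrite gT.
  apply: ideal_gen_min => // x [|/gM//]; exact: monomial_sub_max_ideal.
by move/max_ideal_coef0/eqP; rewrite mcoeff1 eqxx oner_eq0.
Qed.

End PowerMap.

(** * Faces of a finitely generated pointed cone *)

Section Cone.
Variables (F : realFieldType) (V : lmodType F) (G : finType) (v : G -> V).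
Implicit Types (nu : G -> F) (p q w : V) (g : G) (t : F).

Definition comb nu : V := \sum_g nu g *: v g.

Definition cone p := exists2 nu, forall g, 0 <= nu g & comb nu = p.

Lemma combD nu nu' : comb (fun g => nu g + nu' g) = comb nu + comb nu'.
Proof. by rewrite /comb -big_split; apply: eq_bigr => g _; rewrite scalerDl. Qed.

Lemma combZ t nu : comb (fun g => t * nu g) = t *: comb nu.
Proof. by rewrite /comb scaler_sumr; apply: eq_bigr => g _; rewrite scalerA. Qed.

Lemma comb_indic t g : comb (fun g' => if g' == g then t else 0) = t *: v g.
Proof.
rewrite /comb (bigD1 g) //= eqxx big1 ?addr0 // => g' /negbTE ->.
by rewrite scale0r.
Qed.

Lemma cone0 : cone 0.
Proof. by exists (fun=> 0) => //; rewrite /comb big1 // => g _; rewrite scale0r. Qed.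

Lemma coneD p q : cone p -> cone q -> cone (p + q).
Proof.
move=> [nu nu0 <-] [nu' nu'0 <-]; exists (fun g => nu g + nu' g); last exact: combD.
by move=> g; exact: addr_ge0.
Qed.

Lemma coneZ t p : 0 <= t -> cone p -> cone (t *: p).
Proof.
move=> t0 [nu nu0 <-]; exists (fun g => t * nu g); last exact: combZ.
by move=> g; exact: mulr_ge0.
Qed.

Lemma cone_gen g : cone (v g).
Proof.
exists (fun g' => if g' == g then 1 else 0); last by rewrite comb_indic scale1r.
by move=> g'; case: ifP.
Qed.

(** The smallest face of the cone containing q: some positive multiple of w can be split off from q
    within the cone. *)
Definition face q w := cone w /\ exists2 t, 0 < t & cone (q - t *: w).

Lemma face_le q w t t' : cone w -> t' <= t -> cone (q - t *: w) -> cone (q - t' *: w).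
Proof.
move=> cw tt' ct; have -> : q - t' *: w = (q - t *: w) + (t - t') *: w.
  by rewrite scalerBl addrA subrK.
by apply: coneD => //; apply: coneZ => //; rewrite subr_ge0.
Qed.

Lemma face0 q : cone q -> face q 0.
Proof.
by move=> cq; split; [exact: cone0|exists 1; rewrite // scaler0 subr0].
Qed.

(** This equivalence is what makes the ideals attached to faces prime. *)
Lemma faceD q w w' : cone w -> cone w' -> face q (w + w') <-> face q w /\ face q w'.
Proof.
move=> cw cw'; split=> [[_ [t t0 ct]]|[[_ [t t0 ct]] [_ [t' t'0 ct']]]].
  by split; split=> //; exists t => //;
    [rewrite -[q](addrK (t *: w')) -addrA -opprD|rewrite -[q](addrK (t *: w)) -addrA -opprD];
    rewrite addrAC ?[t *: w' + _]addrC -scalerDr ?[w' + w]addrC;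
    apply: coneD => //; apply: coneZ => //; exact: ltW.
split; first exact: coneD.
(* For this d, the point q - (d/2)(w + w') is the midpoint of q - d w and q - d w', both in the
   cone. *)
pose d := Num.min t t'; have d0 : 0 < d by rewrite lt_min t0.
exists (d / 2); first by rewrite divr_gt0.
have -> : q - (d / 2) *: (w + w') = 2^-1 *: (q - d *: w) + 2^-1 *: (q - d *: w').
  rewrite -scalerDr addrACA -opprD -scalerDr scalerBr scalerA mulrC; congr (_ - _).
  by rewrite -mulr2n -scaler_nat scalerA mulVf ?scale1r ?pnatr_eq0.
by apply: coneD; apply: coneZ; rewrite ?invr_ge0 ?ler0n //;
  [apply: face_le ct|apply: face_le ct'] => //; rewrite ge_min lexx ?orbT.
Qed.

Lemma face_mono q a w : cone a -> face q w -> face (q + a) w.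
Proof.
move=> ca [cw [t t0 ct]]; split=> //; exists t => //.
by rewrite addrAC; exact: coneD.
Qed.

Lemma face_add_gen q t g : cone q -> 0 < t -> face (q + t *: v g) (v g).
Proof. by move=> cq t0; split; [exact: cone_gen|exists t; rewrite ?addrK]. Qed.

Lemma face_comb nu g : (forall g', 0 <= nu g') -> 0 < nu g -> face (comb nu) (v g).
Proof.
move=> nu0 nug; split; first exact: cone_gen.
exists (nu g) => //; exists (fun g' => if g' == g then 0 else nu g').
  by move=> g'; case: ifP.
rewrite /comb [in RHS](bigD1 g) //= (bigD1 g) //= eqxx scale0r add0r.
rewrite [RHS]addrC addKr; apply: eq_bigr => g' /negbTE -> //.
Qed.

(** The cone contains no line and no generator is zero, expressed on coefficients. *)
Hypothesis pointed : forall nu, (forall g, 0 <= nu g) -> comb nu = 0 -> forall g, nu g = 0.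

(** The polytope of nonnegative representations of p by generators in A. Over an arbitrary ordered
    field a linear form on it cannot be maximized by compactness. *)
Definition feasible (A : {set G}) p nu :=
  [/\ forall g, 0 <= nu g, forall g, g \notin A -> nu g = 0 & comb nu = p].

(* Either some feasible point on A beats all those with a smaller support, and
   then it is optimal, since from a better one we could move along a line until a
   coordinate vanishes; or the optimum is attained on some A minus a point. *)
Lemma coordinate_max (A : {set G}) p g0 : (exists nu, feasible A p nu) ->
  exists2 nu, feasible A p nu & forall nu', feasible A p nu' -> nu' g0 <= nu g0.
Proof.
have [m] := ubnP #|A|; elim: m A => // m IHm A ltA [nu0 feas0].
have feasS g nu : feasible (A :\ g) p nu -> feasible A p nu.
  case=> nu_ge0 nuA nup; split=> // h hA; apply: nuA.
  by apply: contra hA; rewrite !inE => /andP[].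
have IH g : g \in A -> (exists nu, feasible (A :\ g) p nu) ->
    exists2 nu, feasible (A :\ g) p nu &
      forall nu', feasible (A :\ g) p nu' -> nu' g0 <= nu g0.
  by move=> gA; apply: IHm; move: ltA; rewrite (cardsD1 g) gA.
have [[nu [feas best]]|nobest] := pselect (exists nu, feasible A p nu /\
    forall g nu', g \in A -> feasible (A :\ g) p nu' -> nu' g0 < nu g0).
  exists nu => // nu' feas'; rewrite leNgt; apply/negP => lt_nu.
  have [nu_ge0 nuA nup] := feas; have [nu'_ge0 nu'A nu'p] := feas'.
  pose d g := nu' g - nu g.
  have d0 : comb d = 0.
    rewrite -[RHS](subrr p) -{1}nu'p -nup /comb -sumrB.
    by apply: eq_bigr => g _; rewrite scalerBl.
  (* The relation d is positive at g0, so pointedness forces a negative coordinate elsewhere. *)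
  have [g1 dg1] : exists g, d g < 0.
    apply: contrapT => /forallNP dN.
    have /eqP : d g0 = 0 by apply: pointed => // g; rewrite leNgt; apply/negP; exact: dN.
    by rewrite subr_eq0 gt_eqF.
  (* The step length at which coordinate g of nu + s d vanishes. The smallest one keeps all
     coordinates nonnegative and does not decrease the one at g0. *)
  pose s g := nu g / - d g.
  case: (arg_minP s (dg1 : [pred g | d g < 0] g1)) => g dg mins.
  have g_A : g \in A.
    by apply: contraTT dg => /[dup] gA /nuA nug; rewrite /= /d nug nu'A ?subrr ?ltxx.
  have s_ge0 : 0 <= s g by rewrite divr_ge0 // oppr_ge0 ltW.
  have := best g (fun h => nu h + s g * d h) g_A; rewrite ltNge => /(_ _)/negP; apply.
    split.
    - move=> h; have [dh|dh] := leP 0 (d h); first by rewrite addr_ge0 // mulr_ge0.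
      rewrite -[d h]opprK mulrN subr_ge0 -ler_pdivlMr ?oppr_gt0 //.
      exact: mins.
    - move=> h; rewrite !inE negb_and negbK => /orP[/eqP->|hA].
        by rewrite /s invrN mulrN mulNr divfK ?subrr // lt_eqF.
      by rewrite /d nuA // nu'A // subrr mulr0 addr0.
    - by rewrite combD combZ d0 scaler0 addr0.
  by rewrite lerDl mulr_ge0 // subr_ge0 ltW.
have alt nu : feasible A p nu ->
    exists g nu', [/\ g \in A, feasible (A :\ g) p nu' & nu g0 <= nu' g0].
  move=> feas; apply: contrapT => noalt; apply: nobest; exists nu; split=> // g nu' gA feas'.
  by rewrite ltNge; apply/negP => le_nu; apply: noalt; exists g, nu'.
pose P g := (g \in A) && `[< exists nu, feasible (A :\ g) p nu >].
have /choice[h hP] g : exists nu, P g -> feasible (A :\ g) p nu /\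
    forall nu', feasible (A :\ g) p nu' -> nu' g0 <= nu g0.
  have [/andP[gA /asboolP/(IH g gA)[nu ? ?]]|nP] := boolP (P g); last by exists nu0.
  by exists nu.
have [g1 [nu1 [g1A feas1 _]]] := alt _ feas0.
have Pg1 : P g1 by rewrite /P g1A; apply/asboolP; exists nu1.
case: (arg_maxP (fun g => h g g0) Pg1) => g Pg maxg.
have [hg _] := hP g Pg; exists (h g); first exact: feasS hg.
move=> nu /alt[g2 [nu2 [g2A feas2 le2]]].
have Pg2 : P g2 by rewrite /P g2A; apply/asboolP; exists nu2.
have [_ /(_ _ feas2) le3] := hP g2 Pg2.
exact: le_trans le2 (le_trans le3 (maxg _ Pg2)).
Qed.

(** The bound is the largest coefficient of v g in a representation of p: adding t' at g turns a
    representation of p - t' v g into one of p. *)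
Lemma cone_max p g : cone p -> exists t, [/\ 0 <= t, cone (p - t *: v g) &
  forall t', cone (p - t' *: v g) -> t' <= t].
Proof.
move=> [nu0 nu0_ge0 nu0p].
have [|nu [nu_ge0 _ nup] nu_max] := @coordinate_max [set: G] p g.
  by exists nu0; split=> // h; rewrite inE.
exists (nu g); split=> //.
  exists (fun h => nu h + if h == g then - nu g else 0).
    by move=> h; case: eqP => [->|_]; rewrite ?subrr ?addr0.
  by rewrite combD comb_indic nup scaleNr.
move=> t' [nu' nu'_ge0 nu'p]; have [t'0|t'0] := leP t' 0; first exact: le_trans (nu_ge0 g).
have /nu_max /= : feasible [set: G] p (fun h => nu' h + if h == g then t' else 0).
  split=> [h|h|]; rewrite ?inE //; last by rewrite combD comb_indic nu'p subrK.
  by rewrite addr_ge0 //; case: ifP => // _; exact: ltW.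
by rewrite eqxx; apply: le_trans; rewrite lerDr.
Qed.

(* Subtracting from p the largest multiple of v g that stays in the cone. *)
Lemma face_drop p g : cone p -> face p (v g) -> exists t,
  [/\ 0 < t, cone (p - t *: v g) & ~ face (p - t *: v g) (v g)].
Proof.
move=> cp [_ [d d0 cd]]; have [t [t0 ct tmax]] := cone_max g cp.
exists t; split=> //; first exact: lt_le_trans (tmax _ cd).
move=> [_ [d' d'0]]; rewrite -addrA -opprD -scalerDl => /tmax.
by rewrite gerDl leNgt d'0.
Qed.

Definition face_gens p : {set G} := finset (fun g => `[< face p (v g) >]).

Lemma face_gens_drop p t g : 0 < t -> cone (p - t *: v g) -> face p (v g) ->
  ~ face (p - t *: v g) (v g) -> (#|face_gens (p - t *: v g)| < #|face_gens p|)%N.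
Proof.
move=> t0 ct fg nfg; apply: proper_card; apply/properP; split.
  apply/fintype.subsetP => h; rewrite !inE => fh.
  rewrite -[p](subrK (t *: v g)); apply: (face_mono _ fh).
  exact: coneZ (ltW t0) (cone_gen g).
by exists g; rewrite ?inE //; apply/negP; rewrite inE.
Qed.

Definition wsum (s : seq (F * G)) : V := \sum_(x <- s) x.1 *: v x.2.

(** From each tail to the next longer one the face grows strictly: the added generator lies in the
    larger face but not in the smaller. *)
Fixpoint face_flag (s : seq (F * G)) : Prop :=
  if s is x :: s' then [/\ 0 < x.1, ~ face (wsum s') (v x.2) & face_flag s'] else True.

Lemma face_flag_gt0 s x : face_flag s -> x \in s -> 0 < x.1.
Proof.
elim: s => //= y s IHs [y0 _ /IHs{}IHs]; rewrite inE => /orP[/eqP->//|].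
exact: IHs.
Qed.

Lemma cone_wsum s : {in s, forall x, 0 <= x.1} -> cone (wsum s).
Proof.
move=> s_ge0; rewrite /wsum big_seq; elim/big_ind: _ => [||x /s_ge0 x0].
- exact: cone0.
- by move=> p q; exact: coneD.
- exact: coneZ x0 (cone_gen _).
Qed.

Lemma exists_face_flag p : cone p -> exists2 s, face_flag s & wsum s = p.
Proof.
have [m] := ubnP #|face_gens p|; elim: m p => // m IHm p ltp cp.
(* A positive coefficient puts its generator in the face, so if there is none in the face then p =
   0. *)
have [[g fg]|nof] := pselect (exists g, face p (v g)); last first.
  exists [::] => //; rewrite /wsum big_nil; have [nu nu0 nup] := cp.
  rewrite -nup /comb big1 // => g _; suff -> : nu g = 0 by rewrite scale0r.
  apply/eqP; rewrite eq_le nu0 andbT leNgt; apply/negP => nug.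
  by apply: nof; exists g; rewrite -nup; exact: face_comb.
have [t [t0 ct nfg]] := face_drop cp fg.
have [|s fs sp] := IHm _ _ ct; first exact: leq_trans (face_gens_drop t0 ct fg nfg) ltp.
by exists ((t, g) :: s); rewrite /= ?sp // /wsum big_cons -/(wsum s) sp /= addrC subrK.
Qed.

(** The same greedy subtraction restricted to Q. With Q the variables, the face of the remainder
    gives a prime that contains the maximal ideal. *)
Lemma face_avoid (Q : pred G) p : cone p -> exists nu p0,
  [/\ forall g, 0 <= nu g, forall g, ~~ Q g -> nu g = 0, p = comb nu + p0,
      cone p0 & forall g, Q g -> ~ face p0 (v g)].
Proof.
have [m] := ubnP #|face_gens p|; elim: m p => // m IHm p ltp cp.
have [[g [Qg fg]]|nof] := pselect (exists g, Q g /\ face p (v g)); last first.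
  exists (fun=> 0), p; split=> //; last by move=> g Qg fg; apply: nof; exists g.
  by rewrite /comb big1 ?add0r // => g _; rewrite scale0r.
have [t [t0 ct nfg]] := face_drop cp fg.
have [|nu [p0 [nu0 nuQ pE cp0 fp0]]] := IHm _ _ ct.
  exact: leq_trans (face_gens_drop t0 ct fg nfg) ltp.
exists (fun h => nu h + if h == g then t else 0), p0; split=> //.
- by move=> h; rewrite addr_ge0 //; case: ifP => // _; exact: ltW.
- by move=> h Qh; rewrite nuQ // add0r; case: eqP Qh => // ->; rewrite Qg.
- by rewrite combD comb_indic addrAC -pE subrK.
Qed.

End Cone.

(** * The cone of the Rees algebra *)

Lemma common_denominator (G : finType) (nu : G -> rat) : (forall g, 0 <= nu g) ->
  exists r (N : G -> nat), (0 < r)%N /\ forall g, (N g)%:R = r%:R * nu g.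
Proof.
move=> nu_ge0; pose D g := `|denq (nu g)|%N.
have D_gt0 g : (0 < D g)%N by rewrite absz_gt0 denq_neq0.
pose r := (\prod_g D g)%N; exists r, (fun g => (`|numq (nu g)| * (r %/ D g))%N).
split=> [|g]; first by rewrite prodn_gt0.
have Dr : (D g %| r)%N by rewrite /r (bigD1 g) //= dvdn_mulr.
rewrite -[X in X%:R * nu g](divnK Dr) !natrM -mulrA mulrC; congr (_ * _).
rewrite -[X in _ * X]divq_num_den mulrC -[RHS]mulrC !pmulrn !gez0_abs ?numq_ge0 //.
by rewrite mulrC divfK // intr_eq0 denq_neq0.
Qed.

Section ReesCone.
Variables (n : nat) (B : seq 'X_{1..n}).
Implicit Types (u w b : 'X_{1..n}) (k r : nat).

(** The exponent of x^u t^k, with [None] holding the degree in the Rees variable t. *)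
Definition mvec u k : {ffun option 'I_n -> rat^o} :=
  [ffun o => if o is Some i then (u i)%:R else k%:R].

(* The cone over the exponents (b, 1) of the generators of the ideal and (e_i, 0)
   of the variables, that is of the generators of the Rees algebra. *)
Definition rees_gen (g : 'I_(size B) + 'I_n) : {ffun option 'I_n -> rat^o} :=
  match g with inl j => mvec (nth 0%MM B j) 1 | inr i => mvec U_(i)%MM 0 end.

Local Notation E := [set` B].
Local Notation rcone := (cone rees_gen).

Lemma mvecD u w k r : mvec (u + w)%MM (k + r) = mvec u k + mvec w r.
Proof. by apply/ffunP => -[i|]; rewrite !ffunE ?mnmDE natrD. Qed.

Lemma mvecMn u k r : mvec (u *+ r)%MM (k * r) = r%:R *: mvec u k.
Proof. by apply/ffunP => -[i|]; rewrite !ffunE ?mulmnE natrM mulrC. Qed.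

Lemma mvec0 : mvec 0%MM 0 = 0.
Proof. by apply/ffunP => -[i|]; rewrite !ffunE ?mnm0E. Qed.

Lemma combE nu o : comb rees_gen nu o =
  \sum_j nu (inl j) * rees_gen (inl j) o + \sum_i nu (inr i) * rees_gen (inr i) o.
Proof.
rewrite /comb sum_ffunE big_sumType /=.
by congr (_ + _); apply: eq_bigr => g _; rewrite !ffunE.
Qed.

Lemma comb_None nu : comb rees_gen nu None = \sum_j nu (inl j).
Proof.
rewrite combE /= [X in _ + X]big1 ?addr0 => [|i _]; last by rewrite ffunE mulr0.
by apply: eq_bigr => j _; rewrite ffunE mulr1.
Qed.

Lemma comb_Some nu i : comb rees_gen nu (Some i) =
  \sum_j nu (inl j) * (nth 0%MM B j i)%:R + nu (inr i).
Proof.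
rewrite combE /=; congr (_ + _); first by apply: eq_bigr => j _; rewrite ffunE.
rewrite (bigD1 i) //= ffunE mnm1E eqxx mulr1 big1 ?addr0 // => j /negbTE ji.
by rewrite ffunE mnm1E ji mulr0.
Qed.

(** The degree in t is the sum of the coefficients of the ideal generators, so these vanish first;
    each remaining coordinate is then the coefficient of one variable. *)
Lemma rees_gen_pointed nu : (forall g, 0 <= nu g) -> comb rees_gen nu = 0 ->
  forall g, nu g = 0.
Proof.
move=> nu_ge0 nu0.
have nul j : nu (inl j) = 0.
  have /eqP := comb_None nu; rewrite nu0 ffunE eq_sym psumr_eq0 // => /allP/(_ j).
  by rewrite mem_index_enum => /(_ isT)/eqP.
move=> [j|i]; first exact: nul.
have := comb_Some nu i; rewrite nu0 ffunE big1 ?add0r // => j _.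
by rewrite nul mul0r.
Qed.

Lemma rcone_mvec0 u : rcone (mvec u 0).
Proof.
rewrite [u]multinomUE_id; elim/big_ind: _ => [|u1 u2 c1 c2|i _].
- by rewrite mvec0; exact: cone0.
- by rewrite -[0%N]addn0 mvecD; exact: coneD.
- by rewrite -(mul0n (u i)) mvecMn; apply: coneZ (cone_gen _ (inr i)); rewrite ler0n.
Qed.

Lemma rcone_sumset u w k : sumset E k w -> (w <= u)%MM -> rcone (mvec u k).
Proof.
move=> skw wu; rewrite -(submK wu) -[k]add0n mvecD.
apply: coneD; first exact: rcone_mvec0.
elim: k w skw {wu} => [|k IHk] w /=; first by move=> ->; rewrite mvec0; exact: cone0.
move=> [b /= bB [w' /IHk cw' <-]]; rewrite -add1n mvecD; apply: coneD => //.
have lt_b : (index b B < size B)%N by rewrite index_mem.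
by have := cone_gen rees_gen (inl (Ordinal lt_b)); rewrite /= nth_index.
Qed.

Lemma sumset_big (A : set 'X_{1..n}) (I : Type) (s : seq I) (b : I -> 'X_{1..n}) (N : I -> nat) :
  (forall i, A (b i)) ->
  sumset A (\sum_(i <- s) N i) (\big[+%MM/0%MM]_(i <- s) (b i *+ N i)%MM).
Proof.
move=> Ab; elim: s => [|i s IHs]; rewrite ?big_nil ?big_cons //.
apply: sumsetD => //; rewrite -[X in sumset A X]mul1n; apply: sumset_mulmn.
by exists (b i) => //; exists 0%MM; rewrite ?addm0.
Qed.

(** After clearing denominators, the ideal generators contribute w, and dropping the variables
    leaves the inequality. *)
Lemma rcone_nat u k : rcone (mvec u k) -> exists r w,
  [/\ (0 < r)%N, sumset E (k * r) w & (w <= u *+ r)%MM].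
Proof.
move=> [nu nu_ge0 nuE]; have [r [N [r_gt0 NE]]] := common_denominator nu_ge0.
pose w : 'X_{1..n} := (\sum_(j < size B) nth 0%MM B j *+ N (inl j))%MM.
exists r, w; split=> //.
  suff -> : (k * r)%N = (\sum_(j < size B) N (inl j))%N.
    by apply: sumset_big => j; exact: mem_nth.
  apply/eqP; rewrite -(eqr_nat rat) natrM natr_sum mulrC.
  have -> : k%:R = mvec u k None :> rat by rewrite ffunE.
  rewrite -nuE comb_None mulr_sumr; apply/eqP/eq_bigr => j _.
  by rewrite NE.
apply/mnm_lepP => i; rewrite mulmnE mnm_sumE -(ler_nat rat) natrM natr_sum mulrC.
have -> : (u i)%:R = mvec u k (Some i) :> rat by rewrite ffunE.
rewrite -nuE comb_Some mulrDr mulr_sumr ler_wpDr ?mulr_ge0 ?ler0n // ler_sum // => j _.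
by rewrite mulmnE natrM NE [leLHS]mulrC [leRHS]mulrA.
Qed.

Lemma sumset_split (A : set 'X_{1..n}) i j u : sumset A (i + j) u ->
  exists a c, [/\ sumset A i a, sumset A j c & u = (a + c)%MM].
Proof.
elim: i u => [|i IHi] u /=; first by exists 0%MM, u; rewrite add0m.
move=> [b Ab [u' /IHi[a [c [sa sc ->]]] <-]].
by exists (b + a)%MM, c; split=> //; [exists b => //; exists a|rewrite addmA].
Qed.

Lemma sumset_sumset (A : set 'X_{1..n}) k r u :
  sumset (sumset A k) r u <-> sumset A (k * r) u.
Proof.
elim: r u => [|r IHr] u; first by rewrite muln0.
rewrite mulnS /=; split=> [[b sb [w /IHr sw <-]]|/sumset_split[a [c [sa sc ->]]]].
  exact: sumsetD.
by exists a => //; exists c => //; apply/IHr.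
Qed.

(** Dividing by r in one direction and clearing denominators in the other, the condition u^r in
    I^(kr) for some r becomes membership in a rational cone. *)
Lemma integral_closure_powP (K : fieldType) u k :
  integral_closure (ideal_pow (monomial_span E) k) ('X_[u] : {mpoly K[n]}) <->
  rcone (mvec u k).
Proof.
have powP c r : ideal_pow (ideal_pow (monomial_span E) k) r ('X_[c] ^+ r : {mpoly K[n]}) <->
    exists2 w, sumset E (k * r) w & (w <= c *+ r)%MM.
  rewrite !monomial_span_pow mpolyXn; rewrite monomial_spanX.
  by split=> -[w /sumset_sumset sw wc]; exists w.
split.
  move=> /monomial_spanX[c [r r1 /powP[w sw wc]] cu].
  have : rcone (mvec (u *+ r)%MM (k * r)).
    apply: (rcone_sumset sw); apply: lepm_trans wc _; apply/mnm_lepP => i.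
    by rewrite !mulmnE leq_mul2r (mnm_lepP cu) orbT.
  rewrite mvecMn => /(coneZ (t := r%:R^-1)); rewrite invr_ge0 ler0n => /(_ isT).
  by rewrite scalerA mulVf ?scale1r // pnatr_eq0 -lt0n.
move=> /rcone_nat[r [w [r1 sw wu]]].
apply: sub_ideal_gen; exists u => //; exists r => //; apply/powP; by exists w.
Qed.

End ReesCone.

(** * Primes of the fiber ring *)

Section PrimeImage.
Variables (R Q : comNzRingType) (f : {rmorphism R -> Q}).
Hypothesis f_surj : forall y, exists x, f x = y.
Implicit Type P : set R.

Lemma image_idealE P x : is_ideal P -> (forall x, f x = 0 -> P x) ->
  (f @` P) (f x) <-> P x.
Proof.
move=> Pid kerP; split=> [[y Py /eqP]|Px]; last by exists x.
rewrite -subr_eq0 -rmorphB => /eqP/kerP Pyx; rewrite -(subKr y x).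
exact: idealB.
Qed.

Lemma prime_image P : is_prime_ideal P -> (forall x, f x = 0 -> P x) ->
  is_prime_ideal (f @` P).
Proof.
move=> [Pid P1 PM] kerP; split; first split.
- by exists 0; [exact: ideal0|rewrite rmorph0].
- by move=> _ _ [x Px <-] [y Py <-]; exists (x + y); [exact: idealD|rewrite rmorphD].
- move=> a _ [x Px <-]; have [b <-] := f_surj a.
  by exists (b * x); [exact: is_idealMl|rewrite rmorphM].
- by rewrite -(rmorph1 f) image_idealE.
- move=> a b; have [x <-] := f_surj a; have [y <-] := f_surj b.
  by rewrite -rmorphM !image_idealE //; exact: PM.
Qed.

End PrimeImage.

Lemma krull_dim_quot_ge (R : comNzRingType) (J : idealr R) (P : nat -> set R) d :
  prime_chain P d -> (forall x, x \in J -> P 0%N x) ->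
  ((d%:Z)%:E <= krull_dim ({ideal_quot J} : comNzRingType))%E.
Proof.
move=> [Ppr PS] JP; apply: le_supremum_nat.
have JPi i x : (i <= d)%N -> x \in J -> P i x.
  elim: i => [|i IHi] lei Jx; first exact: JP.
  by have [+ _] := PS i lei; apply; apply: IHi => //; exact: ltnW.
pose f : {rmorphism R -> {ideal_quot J}} := \pi_({ideal_quot J})%qT.
have f_surj y : exists x, f x = y by exists (repr y); exact: reprK.
have kerf i x : (i <= d)%N -> f x = 0 -> P i x.
  move=> lei /eqP; rewrite -(rmorph0 f) /= -Quotient.idealrBE subr0.
  exact: JPi.
exists (fun i => f @` P i); split=> [i lei|i lti].
  by apply: prime_image => // [|x]; [exact: Ppr|exact: kerf].
have [Pi1 _ _] := Ppr i.+1 lti.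
have [PiS /existsNP[x /not_implyP[Px nPx]]] := PS i lti; split.
  by move=> _ [y Py <-]; exists y => //; exact: PiS.
move=> /(_ (f x)); have [Pi0 _ _] := Ppr i (ltnW lti).
rewrite !image_idealE //; first by move=> /(_ Px).
- by move=> y; apply: kerf; exact: ltnW.
- by move=> y; exact: kerf.
Qed.

Lemma if_asboolM (R : pzSemiRingType) (P Q1 Q2 : Prop) (x y : R) :
  (P <-> Q1 /\ Q2) ->
  (if `[< Q1 >] then x else 0) * (if `[< Q2 >] then y else 0) =
  if `[< P >] then x * y else 0.
Proof.
by case: asboolP => h1; case: asboolP => h2; case: asboolP => h3; rewrite ?mul0r ?mulr0 //;
  tauto.
Qed.

Section FiberRing.
Variables (K : fieldType) (n : nat) (B : seq 'X_{1..n}).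
Local Notation S := {mpoly K[n]}.
Local Notation I := (monomial_span [set` B] : set S).
Local Notation rees_gen := (@rees_gen n B).
Local Notation face := (face rees_gen).
Local Notation rcone := (cone rees_gen).
Implicit Types (b u : 'X_{1..n}) (k : nat) (q : {ffun option 'I_n -> rat^o}).

(** Keeps the terms with exponent in the face of q. On the Rees algebra, whose exponents lie in the
    cone, [faceD] makes this multiplicative. *)
Definition face_part q (p : {poly S}) : {poly S} :=
  \poly_(k < size p)
    \sum_(b <- msupp p`_k | `[< face q (mvec b k) >]) p`_k@_b *: 'X_[b].

Lemma mcoeff_filter (P : pred 'X_{1..n}) (f : S) b :
  (\sum_(m <- msupp f | P m) f@_m *: 'X_[m])@_b = if P b then f@_b else 0.
Proof.
rewrite raddf_sum /= big_mkcond /=.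
under eq_bigr => m _ do rewrite mcoeffZ mcoeffX.
have -> : (if P b then f@_b else 0) =
    \sum_(m <- msupp f) if P b then f@_m * (m == b)%:R else 0.
  case: ifP => _; last by rewrite big1.
  rewrite {1}(mpolyE f) raddf_sum /=; apply: eq_bigr => m _.
  by rewrite mcoeffZ mcoeffX.
apply: eq_bigr => m _; case: eqP => [->//|_].
by rewrite mulr0 !if_same.
Qed.

Lemma coef_face_part q p k b :
  ((face_part q p)`_k)@_b = if `[< face q (mvec b k) >] then p`_k@_b else 0.
Proof.
rewrite coef_poly; case: ltnP => [_|le_k]; first exact: mcoeff_filter.
by rewrite (nth_default 0 le_k) mcoeff0 if_same.
Qed.

Lemma face_part_eq0 q p : face_part q p = 0 <->
  forall k b, face q (mvec b k) -> p`_k@_b = 0.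
Proof.
split=> [p0 k b fb|p0].
  by have := coef_face_part q p k b; rewrite p0 coef0 mcoeff0; case: asboolP.
apply/polyP => k; apply/mpolyP => b; rewrite coef_face_part coef0 mcoeff0.
by case: asboolP => // /p0.
Qed.

Lemma face_partD q p p' : face_part q (p + p') = face_part q p + face_part q p'.
Proof.
apply/polyP => k; apply/mpolyP => b; rewrite coefD mcoeffD !coef_face_part.
by case: ifP; rewrite ?coefD ?mcoeffD ?addr0.
Qed.

Lemma rees_rcone (p : rees_algebra I) k b : (val p)`_k@_b != 0 -> rcone (mvec b k).
Proof.
rewrite -mcoeff_msupp => bp; have /asboolP/(_ k) := valP p.
rewrite monomial_span_pow => /monomial_spanP/(_ b bp)[w sw wb].
exact: rcone_sumset sw wb.
Qed.

Lemma coef_face_partM q (p p' : rees_algebra I) k l b c :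
  ((face_part q (val p))`_k)@_b * ((face_part q (val p'))`_l)@_c =
  if `[< face q (mvec (b + c)%MM (k + l)) >] then ((val p)`_k)@_b * ((val p')`_l)@_c
  else 0.
Proof.
rewrite !coef_face_part.
have [->|/rees_rcone cp] := eqVneq ((val p)`_k)@_b 0; first by rewrite !if_same !mul0r if_same.
have [->|/rees_rcone cp'] := eqVneq ((val p')`_l)@_c 0; first by rewrite !if_same !mulr0 if_same.
have fD : face q (mvec (b + c)%MM (k + l)) <-> face q (mvec b k) /\ face q (mvec c l).
  by rewrite mvecD; exact: (faceD q cp cp').
exact: (if_asboolM _ _ fD).
Qed.

Lemma face_partM q (p p' : rees_algebra I) :
  face_part q (val p * val p') = face_part q (val p) * face_part q (val p').
Proof.
apply/polyP => k; apply/mpolyP => b; rewrite coef_face_part !coefM !raddf_sum /=.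
have coefMik (i : 'I_k.+1) : (((face_part q (val p))`_i * (face_part q (val p'))`_(k - i))@_b =
    if `[< face q (mvec b k) >] then ((val p)`_i * (val p')`_(k - i))@_b else 0).
  rewrite !mcoeffM.
  transitivity (\sum_(c : 'X_{1..n < (mdeg b).+1, (mdeg b).+1} | b == (c.1 + c.2)%MM)
    if `[< face q (mvec b k) >] then ((val p)`_i)@_c.1 * ((val p')`_(k - i))@_c.2 else 0).
    apply: eq_bigr => c /eqP bE; rewrite coef_face_partM -bE subnKC // -ltnS.
    exact: ltn_ord.
  by case: ifP => // _; rewrite big1.
under [RHS]eq_bigr => i _ do rewrite coefMik.
by case: ifP => // _; rewrite big1.
Qed.

Definition face_prime q : set (rees_algebra I) := [set p | face_part q (val p) = 0].

(** The kernel of a multiplicative map into the domain of polynomials over S. It omits 1 because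
    every face contains 0. *)
Lemma face_prime_prime q : rcone q -> is_prime_ideal (face_prime q).
Proof.
move=> cq; split; first split; rewrite /face_prime /=.
- by apply/face_part_eq0 => k b _; rewrite coef0 mcoeff0.
- by move=> p p' fp fp'; rewrite face_partD fp fp' addr0.
- by move=> p p' fp; rewrite face_partM fp mulr0.
- move=> /face_part_eq0/(_ 0%N 0%MM); rewrite mvec0 => /(_ (face0 cq))/eqP.
  by rewrite coef1 mcoeff1 eqxx oner_eq0.
- by move=> p p'; rewrite face_partM => /eqP; rewrite mulf_eq0 => /orP[/eqP|/eqP]; [left|right].
Qed.

(** If a nonconstant monomial of S had its exponent in the face, [faceD] would put there a variable
    dividing it. *)
Lemma max_rees_face_prime q : rcone q ->
  (forall i, ~ face q (rees_gen (inr i))) -> max_rees I `<=` face_prime q.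
Proof.
move=> cq fq; apply: ideal_gen_min; first by have [] := face_prime_prime cq.
move=> p [f /max_ideal_coef0 f0 pf]; apply/face_part_eq0 => k b fb.
rewrite pf coefC; case: eqP => [k0|_]; last by rewrite mcoeff0.
have [->//|/eqP b0] := eqVneq b 0%MM; exfalso.
have /existsP[i bi] : [exists i, b i != 0%N].
  apply: contrapT => /negP/existsPn b0'; apply: b0; apply/mnmP => i.
  by rewrite mnm0E; apply/eqP/negPn.
have Ub : (U_(i) <= b)%MM by rewrite lep1mP.
have bE : mvec b k = mvec U_(i)%MM 0 + mvec (b - U_(i))%MM 0.
  by rewrite -mvecD addmC submK // k0.
move: fb; rewrite bE => /(faceD q (cone_gen _ (inr i)) (rcone_mvec0 B _))[+ _].
exact: fq.
Qed.

Lemma face_prime_sub q q' :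
  (forall w, face q' w -> face q w) -> face_prime q `<=` face_prime q'.
Proof.
move=> qq' p /face_part_eq0 fp; apply/face_part_eq0 => k b /qq'; exact: fp.
Qed.

Lemma face_prime_gen q j : face_part q ('X_[nth 0%MM B j] *: 'X : {poly S}) = 0 <->
  ~ face q (mvec (nth 0%MM B j) 1).
Proof.
rewrite face_part_eq0; split=> [/(_ 1%N (nth 0%MM B j)) + fj|nf k b fb].
  by move=> /(_ fj)/eqP; rewrite coefZ coefX mulr1 mcoeffX eqxx oner_eq0.
rewrite coefZ coefX; case: eqP => [k1|_]; last by rewrite mulr0 mcoeff0.
rewrite mulr1 mcoeffX; case: eqP => // jb.
by case: nf; rewrite jb; rewrite k1 in fb.
Qed.

Lemma gen_rees (j : 'I_(size B)) :
  ('X_[nth 0%MM B j] *: 'X : {poly S}) \in rees_pred I.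
Proof.
apply/asboolP => k; rewrite coefZ coefX; case: eqP => [->|_]; last first.
  by rewrite mulr0; exact: ideal0 (ideal_powP _ _).
rewrite mulr1 monomial_span_pow; apply/monomial_spanX.
exists (nth 0%MM B j); last exact: lepm_refl.
by exists (nth 0%MM B j); [exact: mem_nth|exists 0%MM; rewrite ?addm0].
Qed.

(** The tails of s have decreasing faces, hence increasing primes, and these contain the maximal
    ideal since no variable lies in any of the faces. *)
Lemma analytic_spread_ge (s : seq (rat * ('I_(size B) + 'I_n))) :
  face_flag rees_gen s ->
  (forall i, ~ face (wsum rees_gen s) (rees_gen (inr i))) ->
  (((size s)%:Z)%:E <= analytic_spread I)%E.
Proof.
move=> fs fe; pose q i := wsum rees_gen (drop i s).
have dropS i : (i < size s)%N -> exists x, drop i s = x :: drop i.+1 s.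
  by case: (s) => [//|x0 s'] lt_i; exists (nth x0 (x0 :: s') i); rewrite -drop_nth.
have flag i : face_flag rees_gen (drop i s).
  elim: i s fs {fe q dropS} => [|i IHi] [|x s] //=; move=> [_ _ fs]; exact: IHi.
have cq i : rcone (q i).
  by apply: cone_wsum => x /mem_drop; move/(face_flag_gt0 fs)/ltW.
have qS i : (i < size s)%N -> exists t g, [/\ 0 < t, q i = q i.+1 + t *: rees_gen g
    & ~ face (q i.+1) (rees_gen g)].
  move=> /dropS[[t g] di]; have := flag i; rewrite /q di /= => -[t0 nf _].
  by exists t, g; split=> //; rewrite /wsum big_cons addrC.
have qSface i w : (i < size s)%N -> face (q i.+1) w -> face (q i) w.
  move=> /qS[t [g [t0 -> _]]]; apply: face_mono.
  by apply: coneZ (cone_gen _ _); exact: ltW.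
have qface i w : (i <= size s)%N -> face (q i) w -> face (q 0%N) w.
  by elim: i => // i IHi lti /(qSface _ _ lti)/IHi; apply; exact: ltnW.
have qe i j : (i <= size s)%N -> ~ face (q i) (rees_gen (inr j)).
  by move=> lei /(qface _ _ lei); rewrite /q drop0; exact: fe.
apply: (krull_dim_quot_ge (J := max_rees_pred I) (P := fun i => face_prime (q i))).
  split=> [i lei|i lti]; first exact: face_prime_prime.
  split; first by apply: face_prime_sub => w; exact: qSface.
  (* The generator lost at step i is not a variable, so it is some b of I, and b t lies in the
     larger prime only. *)
  have [t [[j|j] [t0 qi nf]]] := qS i lti; last first.
    case: (qe i j (ltnW lti)); rewrite qi; exact: face_add_gen.
  move=> /(_ (ReesAlgebra (gen_rees j))); rewrite /face_prime /= => sub.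
  have /face_prime_gen : face_part (q i) ('X_[nth 0%MM B j] *: 'X : {poly S}) = 0.
    by apply: sub; apply/face_prime_gen.
  by apply; rewrite qi; exact: face_add_gen.
move=> x /set_mem; apply: max_rees_face_prime => // j; exact: qe.
Qed.

End FiberRing.

(** * Reduction of integral closures *)

Section Reduction.
Variables (K : fieldType) (n : nat) (B : seq 'X_{1..n}).
Local Notation S := {mpoly K[n]}.
Local Notation E := [set` B].
Local Notation I := (monomial_span E : set S).
Local Notation rees_gen := (@rees_gen n B).
Local Notation rcone := (cone rees_gen).
Implicit Types (u v w b : 'X_{1..n}) (k : nat).

Variable l : nat.
Hypothesis spreadI : analytic_spread I = (l%:Z)%:E.

Lemma rees_gen_ge0 g o : 0 <= rees_gen g o.
Proof. by case: g => i; rewrite ffunE; case: o => *; rewrite ler0n. Qed.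

Lemma rcone_ge0 p o : rcone p -> 0 <= p o.
Proof.
move=> [nu nu_ge0 <-]; rewrite /comb sum_ffunE sumr_ge0 // => g _.
by rewrite ffunE mulr_ge0 // rees_gen_ge0.
Qed.

(** First the variables are subtracted, giving a; the rest is written by a flag whose face avoids
    the variables, so its length is at most the analytic spread. *)
Lemma rees_decomposition u k : rcone (mvec u k) -> exists s a,
  [/\ face_flag rees_gen s, (size s <= l)%N, rcone a,
      mvec u k = a + wsum rees_gen s & a None = 0].
Proof.
have pointed := @rees_gen_pointed n B.
move=> /(face_avoid pointed (fun g => if g is inr _ then true else false)).
move=> [nu [p0 [nu_ge0 nu0 -> cp0 fp0]]].
have [s fs sp0] := exists_face_flag pointed cp0.
exists s, (comb rees_gen nu); split=> //; rewrite ?sp0 //.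
- rewrite -lez_nat -lee_fin -spreadI; apply: analytic_spread_ge => // i.
  by rewrite sp0; exact: fp0.
- by exists nu.
- by rewrite comb_None big1 // => j _; exact: nu0.
Qed.

Lemma wsum_None s : wsum rees_gen s None =
  \sum_(x <- s) if x.2 is inl _ then x.1 else 0.
Proof.
rewrite /wsum sum_ffunE; apply: eq_bigr => -[t [j|i]] _; rewrite !ffunE /=.
  exact: mulr1.
exact: mulr0.
Qed.

(** With no term in the flag, only a part of degree 0 would remain. The bound makes l - 1 a true
    subtraction. *)
Lemma analytic_spread_gt0 u : rcone (mvec u 1) -> (0 < l)%N.
Proof.
move=> /rees_decomposition[s [a [_ le_sl _ uE a0]]]; apply: leq_trans le_sl.
case: s uE => // /(congr1 (fun p : {ffun _} => p None)).
by rewrite !ffunE a0 wsum_None big_nil addr0 => /eqP; rewrite oner_eq0.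
Qed.

(* The degree k is the sum of at most l <= k coefficients, so one of them is at
   least 1 and the corresponding generator can be split off. *)
Lemma integral_closure_reduction u k : (0 < k)%N -> (l <= k)%N -> rcone (mvec u k) ->
  exists b, [/\ b \in B, (b <= u)%MM & rcone (mvec (u - b)%MM (k - 1))].
Proof.
move=> k0 le_lk /rees_decomposition[s [a [fs le_sl ca uE a0]]].
have kE : k%:R = \sum_(x <- s) if x.2 is inl _ then x.1 else 0 :> rat.
  rewrite -wsum_None; have := congr1 (fun p : {ffun _} => p None) uE.
  by rewrite !ffunE a0 add0r.
have [t [j [tjs t1]]] : exists t j, (t, inl j) \in s /\ 1 <= t.
  apply: contrapT => noj.
  have s0 : s != [::] by apply/eqP => s0; move: kE k0; rewrite s0 big_nil => /eqP; rewrite pnatr_eq0 => /eqP->.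
  have : (k%:R : rat) < (size s)%:R.
    have -> : (size s)%:R = \sum_(x <- s) 1%:R :> rat by rewrite -natr_sum sum1_size.
    rewrite kE big_seq [ltRHS]big_seq; apply: ltr_sum.
      by case: (s) s0 => // x s' _; rewrite /= mem_head.
    move=> [t [j|i]] ts /=; last exact: ltr01.
    by rewrite ltNge; apply/negP => t1; apply: noj; exists t, j.
  by rewrite ltr_nat ltnNge (leq_trans le_sl le_lk).
set b := nth 0%MM B j; exists b.
(* Here p is the same decomposition with the coefficient of b lowered by 1. *)
have [p cp pE] : exists2 p, rcone p & mvec u k = p + mvec b 1.
  exists (a + ((t - 1) *: mvec b 1 + wsum rees_gen (rem (t, inl j) s))).
    apply: coneD => //; apply: coneD.
      by apply: (coneZ _ (cone_gen _ (inl j))); rewrite subr_ge0.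
    by apply: cone_wsum => x /mem_rem; move/(face_flag_gt0 fs)/ltW.
  rewrite uE /wsum (big_rem _ tjs) /= -addrA; congr (_ + _).
  by rewrite addrAC scalerBl scale1r subrK.
have bu : (b <= u)%MM.
  apply/mnm_lepP => i; rewrite -(ler_nat rat).
  have := congr1 (fun f : {ffun _} => f (Some i)) pE; rewrite !ffunE => ->.
  by rewrite lerDr rcone_ge0.
split=> //; first exact: mem_nth.
suff -> : mvec (u - b)%MM (k - 1) = p by [].
by apply: (addIr (mvec b 1)); rewrite -pE -mvecD submK // subnK.
Qed.

Local Notation closure_pow k := (integral_closure (ideal_pow I k)).

Lemma min_gens_below (J : set S) u : J 'X_[u] -> exists2 v, min_gens J v & (v <= u)%MM.
Proof.
have [m] := ubnP (mdeg u); elim: m u => // m IHm u ltu Ju.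
have [|nmin] := pselect (min_gens J u); first by exists u => //; exact: lepm_refl.
have [v [Jv vu /eqP vNu]] : exists v, [/\ J 'X_[v], (v <= u)%MM & v <> u].
  apply: contrapT => nov; apply: nmin; split=> // v Jv vu.
  by apply: contrapT => vNu; apply: nov; exists v.
have [|w Jw wv] := IHm v _ Jv; last by exists w => //; exact: lepm_trans wv vu.
apply: leq_trans _ (ltu : (mdeg u <= m)%N).
rewrite -(submK vu) mdegD -[ltnLHS]add0n ltn_add2r lt0n mdeg_eq0.
by apply: contra vNu => /eqP uv0; rewrite -(submK vu) uv0 add0m.
Qed.

(** Needed because [fset_set], through which [mu] counts, is meaningful only on finite sets. *)
Lemma min_gens_finite (J : set S) : finite_set (min_gens J).
Proof.
have [s _ sP] := dickson [set u | J 'X_[u]].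
have [t tJ tP] := dickson (min_gens J).
apply: (@sub_finite_set _ _ [set` t]); last exact: finite_seq.
move=> u Ju; have [v vt vu] := tP u Ju; have [Jv _] := tJ v vt.
by have [_ /(_ v Jv vu) uv] := Ju; rewrite /= -uv.
Qed.

(* Multiplication by u maps every minimal generator v of the closure of I^(l-1)
   into I times that closure, hence to a multiple of b v' for some generator b
   of I and minimal generator v'; the map v -> v' has a cycle, of some length k,
   and going around it shows that u^k lies in I^k. *)
Lemma integral_closure_power u : rcone (mvec u 1) ->
  let s := (mu (closure_pow (l - 1)))`! in
  exists2 w, sumset E s w & (w <= u *+ s)%MM.
Proof.
move=> cu /=; set J := closure_pow (l - 1).
have l_gt0 := analytic_spread_gt0 cu.
have JP w : J 'X_[w] <-> rcone (mvec w (l - 1)) by exact: integral_closure_powP.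
pose V := fset_set (min_gens J).
have VP w : w \in V <-> min_gens J w.
  by rewrite /V in_fset_set ?inE //; exact: min_gens_finite.
have next (v : V) : exists v' : V,
    exists2 b, b \in B & (b + val v' <= u + val v)%MM.
  have /VP[/JP cv _] := valP v.
  have cuv : rcone (mvec (u + val v)%MM l) by rewrite -(subnKC l_gt0) mvecD; exact: coneD.
  have [b [bB le_b /JP]] := integral_closure_reduction l_gt0 (leqnn l) cuv.
  move=> /min_gens_below[v' /VP v'V le_v']; exists (FSetSub v'V), b => //=.
  by rewrite -(submK le_b) addmC; exact: lepm_add le_v' (lepm_refl _).
have [f fP] := choice next.
have iterP (v : V) k : exists2 w, sumset E k w & (w + val (iter k f v) <= u *+ k + val v)%MM.
  elim: k => [|k [w sw le_w]]; first by exists 0%MM => //=; exact: lepm_refl.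
  have [b bB le_b] := fP (iter k f v); exists (b + w)%MM; first by exists b => //; exists w.
  apply/mnm_lepP => h; have := mnm_lepP le_b h; have := mnm_lepP le_w h.
  by rewrite mulmS iterS !mnmDE; lia.
(* The closure contains u^(l-1), so there is a generator to start from. *)
have [v0 _] : exists v : V, True.
  have /min_gens_below[v /VP vV _] : J 'X_[u *+ (l - 1)].
    by apply/JP; rewrite -{2}[(l - 1)%N]mul1n mvecMn; apply: coneZ cu; rewrite ler0n.
  by exists (FSetSub vV).
(* Pigeonhole on the iterates of index 0 to the cardinality of V; the cycle length j - i is then at
   most [mu J] and divides its factorial. *)
have [i [j [ltij lejV fij]]] : exists i j,
    [/\ (i < j)%N, (j <= #|{: V}|)%N & iter i f v0 = iter j f v0].
  have : ~~ injectiveb (fun i : 'I_#|{: V}|.+1 => iter i f v0).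
    by apply/negP => /injectiveP/leq_card; rewrite card_ord ltnn.
  move=> /injectivePn[x [y xy fxy]]; wlog ltxy : x y xy fxy / (x < y)%N.
    move=> gen; have [ltxy|ltyx|/val_inj xey] := ltngtP x y; first exact: gen fxy _.
      by apply: (gen y x); rewrite // eq_sym.
    by rewrite xey eqxx in xy.
  by exists x, y; split=> //; rewrite -ltnS.
pose k := (j - i)%N; have k_gt0 : (0 < k)%N by rewrite subn_gt0.
have muE : mu J = #|{: V}| by rewrite /mu cardfE.
have /dvdnP[r rE] : (k %| (mu J)`!)%N.
  by apply: dvdn_fact; rewrite k_gt0 muE (leq_trans _ lejV) // leq_subr.
have [w sw le_w] := iterP (iter i f v0) k.
have {}le_w : (w <= u *+ k)%MM.
  move: le_w; rewrite -iterD subnK ?(ltnW ltij) // -fij => /mnm_lepP le_w.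
  by apply/mnm_lepP => h; have := le_w h; rewrite !mnmDE leq_add2r.
rewrite rE mulnC; exists (w *+ r)%MM; first exact: sumset_mulmn.
by apply/mnm_lepP => h; rewrite !mulmnE mulnA leq_mul2r -mulmnE (mnm_lepP le_w) orbT.
Qed.

End Reduction.

Theorem theorem4p5 (K : fieldType) (n : nat) (I : set {mpoly K[n]})
  (hI : is_monomial_ideal I)
  (l : nat) (hl : analytic_spread I = (l%:Z)%:E)
  (m : nat) (hm : (1 <= m)%N) :
  let s := (mu (integral_closure (ideal_pow I (l - 1))))`! in
  (depth_quot max_ideal (ideal_pow I (s * m))
     <= depth_quot max_ideal (integral_closure I))%E.
Proof.
have [B IB] := monomial_ideal_finite hI; move: hl; rewrite {}IB => hl; lazy zeta.
set s := (mu _)`!.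
have q_gt0 : (0 < s * m)%N by rewrite muln_gt0 fact_gt0.
rewrite monomial_span_pow; apply: (depth_quot_power q_gt0) => u; split; last first.
  (* This direction is the definition of the closure with exponent r = s m. *)
  rewrite -monomial_span_pow -mpolyXn => pu.
  by apply: sub_ideal_gen; exists u => //; exists (s * m)%N.
(* I is read as I^1, the form that [integral_closure_powP] expects. *)
have -> : monomial_span [set` B] = ideal_pow (monomial_span [set` B]) 1 :> set {mpoly K[n]}.
  rewrite monomial_span_pow; congr monomial_span; apply/seteqP; split=> [b bB|b].
    by exists b => //; exists 0%MM; rewrite ?addm0.
  by move=> [c cB [_ -> <-]]; rewrite addm0.
move=> /integral_closure_powP/(integral_closure_power hl)[w sw le_w].
apply/monomial_spanX; exists (w *+ m)%MM; first exact: sumset_mulmn.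
by apply/mnm_lepP => i; rewrite !mulmnE mulnA leq_mul2r -mulmnE (mnm_lepP le_w) orbT.
Qed.
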